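(* If $K\subset\mathbb C$ is a totally disconnected compact set and $\mathcal H^1(K)<\infty$, then $K$ is removable for holomorphic functions with bounded derivative.
   Context: $\mathcal H^1$ is one-dimensional Hausdorff measure. A compact set $K\subset\mathbb C$ is removable for holomorphic functions with bounded derivative if every holomorphic function $f\colon\mathbb C\setminus K\to\mathbb C$ with $\sup_{z\in\mathbb C\setminus K}|f'(z)|<\infty$ extends to an entire function. *)

(* Defs.v *)
From HB Require Import structures.
From mathcomp Require Import all_boot all_order all_algebra.
From mathcomp Require Import all_classical all_reals all_analysis.
From mathcomp Require Import complex.

Set Implicit Arguments.
Unset Strict Implicit.
Unset Printing Implicit Defensive.

Import Order.TTheory GRing.Theory Num.Theory.
Import numFieldNormedType.Exports.
Import ComplexField.Normc.

Local Open Scope ring_scope.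
Local Open Scope classical_set_scope.

(* R[i] carries the topology of its complex modulus and is normed over itself,
   so that derivable f z 1 and derive1 f refer to complex differentiation. *)
#[warnings="-redundant-canonical-projection"]
HB.instance Definition _ (R : realType) := NormedModule.copy R[i] R[i]^o.

Section Definitions.
Context {R : realType}.
Implicit Types (A K U : set R[i]) (f g : R[i] -> R[i]).

(* 0 is adjoined so that the diameter of set0 is 0 rather than -oo. *)
Definition diameter A : \bar R :=
  ereal_sup (0%E |` [set (normc (p.1 - p.2))%:E | p in A `*` A]).

(* The normalization is the one without a constant in front of the diameters:
   the measure of a segment is its length. *)
Definition hausdorff_content (delta : R) A : \bar R :=
  ereal_inf [set (\sum_(0 <= n <oo) diameter (E n))%E | E in
    [set E : (set R[i])^nat | A `<=` \bigcup_n E n /\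
                              forall n, (diameter (E n) <= delta%:E)%E]].

Definition hausdorff_measure1 A : \bar R :=
  ereal_sup [set hausdorff_content delta A | delta in [set delta : R | 0 < delta]].

Definition holomorphic U f := forall z, U z -> derivable f z 1.

Definition entire f := holomorphic setT f.

(* A function on the complement of K is represented by any total function;
   holomorphic (~` K) f depends only on the values outside K since that set is
   open for compact K. *)
Definition removable_bounded_derivative K :=
  forall f, holomorphic (~` K) f ->
    (ereal_sup [set (normc (derive1 f z))%:E | z in ~` K] < +oo)%E ->
    exists g, entire g /\ forall z, (~` K) z -> g z = f z.

End Definitions.

(* Main.v *)
Require Import Defs.
From mathcomp Require Import finmap.
From mathcomp Require Import all_boot all_order all_algebra.
From mathcomp Require Import all_classical all_reals all_analysis.
From mathcomp Require Import complex ring lra.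

Set Implicit Arguments.
Unset Strict Implicit.
Unset Printing Implicit Defensive.

Import Order.TTheory GRing.Theory Num.Theory.
Import numFieldNormedType.Exports.
Import ComplexField.Normc.

Local Open Scope ring_scope.
Local Open Scope classical_set_scope.
Local Open Scope complex_scope.

Local Notation Re := complex.Re.
Local Notation Im := complex.Im.

(* Fix z outside K, put u = f - f z and k(w) = 1/(w - z), and cover K by finitely
   many small squares of bounded total side.  On a fine grid let U be the union of
   the cells meeting these squares.  Off U the function u k is holomorphic, so by
   Goursat its integral over the boundary of a large square Q equals the one over the
   boundary of U.  As K is totally disconnected, k has near K a locally defined
   primitive psi that is uniformly small: integrate k from a base point which is
   locally constant in the variable and close to it.  The differences of u psi along
   the edges of U sum to 0, so integration by parts leaves the integral of - psi du
   over the boundary of U; it is bounded by sup |psi| times sup |f'| times the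
   length of that boundary, and tends to 0.  Hence Cauchy's formula holds for f on Q
   at every z outside K, and the Cauchy integral extends f. *)

(** * Modulus and complex differentiability *)

Section Modulus.
Context {R : realType}.
Implicit Types (z w : R[i]) (x y : R).

(** Finite length keeps the contours around [K] bounded in length, not short, so a bound on the
    integrand along them would not make the integral small. The small factor has to come from psi,
    and this shapes the rest: each edge must use one base point for both of its ends, and that base
    point must stay close. Chains in [K] with small steps provide it: their classes shrink to
    connected subsets of [K], which are points. The values of f near [K] are never estimated; only
    increments along single edges enter, through the mean value inequality. The integrand u k takes
    the default value 0 at z, so z gets a small square of its own, where boundedness of the
    difference quotient suffices. The constant 2 pi i is never computed. With [num] and [den] the
    Cauchy integrals of f and of 1 over the boundary of Q, the vanishing integral reads
    [num z = f z * den z]; since [den] has no zero inside Q, [num / den] is the extension. *)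

Lemma normc_ge0 z : 0 <= normc z.
Proof. by case: z => a b; rewrite /= sqrtr_ge0. Qed.

Lemma normc_le_ReIm z : normc z <= `|Re z| + `|Im z|.
Proof.
case: z => a b /=; rewrite -(ler_pXn2r (ltn0Sn 1)) ?nnegrE ?sqrtr_ge0 ?addr_ge0//.
rewrite sqr_sqrtr ?addr_ge0 ?sqr_ge0// sqrrD !real_normK ?num_real//.
by have := mulr_ge0 (normr_ge0 a) (normr_ge0 b); lra.
Qed.

Lemma Re_le_normc z : `|Re z| <= normc z.
Proof. by rewrite -lecR; apply: normc_ge_Re. Qed.

Lemma Im_le_normc z : `|Im z| <= normc z.
Proof.
case: z => a b /=; rewrite -sqrtr_sqr ler_sqrt ?addr_ge0 ?sqr_ge0//.
by rewrite lerDr sqr_ge0.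
Qed.

Lemma cReD z w : Re (z + w) = Re z + Re w. Proof. by case: z; case: w. Qed.
Lemma cImD z w : Im (z + w) = Im z + Im w. Proof. by case: z; case: w. Qed.
Lemma cReN z : Re (- z) = - Re z. Proof. by case: z. Qed.
Lemma cImN z : Im (- z) = - Im z. Proof. by case: z. Qed.
Lemma cReM z w : Re (z * w) = Re z * Re w - Im z * Im w.
Proof. by case: z; case: w. Qed.
Lemma cImM z w : Im (z * w) = Re z * Im w + Im z * Re w.
Proof. by case: z; case: w. Qed.

Lemma normc_real x : normc x%:C = `|x|.
Proof. by rewrite /= expr0n addr0 sqrtr_sqr. Qed.

Lemma normc_gt0 z : (0 < normc z) = (z != 0).
Proof.
rewrite lt_neqAle normc_ge0 andbT eq_sym; congr negb.
by apply/eqP/eqP => [/eq0_normc|->] //; rewrite normc0.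
Qed.

Lemma normcB z w : normc (z - w) = normc (w - z).
Proof. by rewrite -normcN opprB. Qed.

Lemma normcE_norm z : `|z| = (normc z)%:C.
Proof. by []. Qed.

Lemma normcD_le z w : normc (z + w) <= normc z + normc w.
Proof. exact: le_normcD. Qed.

Lemma normc_triangle z w u : normc (z - u) <= normc (z - w) + normc (w - u).
Proof. by rewrite -[z - u](subrKA w); exact: le_normcD. Qed.

Lemma normc_le_sum z w : normc z <= normc (z - w) + normc w.
Proof. by rewrite -{1}(subrK w z); exact: le_normcD. Qed.

Lemma pos_complex (e : R[i]) : 0 < e -> e = (Re e)%:C /\ 0 < Re e.
Proof.
by case: e => a b; rewrite ltcE /= => /andP[/eqP -> ?].
Qed.

Lemma nbhs_normcP z (A : set R[i]) :
  nbhs z A <-> exists2 r : R, 0 < r & forall w, normc (w - z) < r -> A w.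
Proof.
split.
  move=> /nbhs_normP[/= e /pos_complex[-> e0] H]; exists (Re e) => // w wz.
  by apply: H; rewrite /= /ball_ /= normcE_norm ltcR normcB.
move=> [r r0 H]; apply/nbhs_normP; exists r%:C => /=; first by rewrite ltcR.
by move=> w /=; rewrite normcE_norm ltcR normcB => /H.
Qed.

(** The multiplied-out form of the limit, with real radii: no quotient occurs, so [w = z] needs no
    exclusion. *)
Definition cdiff (f : R[i] -> R[i]) z d := forall e, 0 < e ->
  exists2 r : R, 0 < r & forall w, normc (w - z) < r ->
    normc (f w - f z - d * (w - z)) <= e * normc (w - z).

Lemma derivable_cdiff f z : derivable f z 1 -> cdiff f z (derive1 f z).
Proof.
move=> df e e0.
have : (fun h => h^-1 *: (f (h *: 1 + z) - f z)) @ 0^' --> 'D_1 f z by exact: df.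
rewrite -derive1E.
move=> /cvgrPdist_lt /(_ e%:C); rewrite ltcR => /(_ e0).
move=> /nbhs_normcP[r r0 H].
exists r => // w wz.
have [->|nwz] := eqVneq w z.
  by rewrite !subrr mulr0 subrr normc0 mulr0.
have wz0 : w - z != 0 by rewrite subr_eq0.
have := H (w - z); rewrite subr0 => /(_ wz wz0).
rewrite /= normcE_norm ltcR => /ltW.
have -> : (w - z) *: (1 : R[i]) + z = w by rewrite -[_ *: _]/(_ * _) mulr1 subrK.
rewrite -[_ *: (f w - f z)]/(_ * _) => Hw.
have -> : f w - f z - derive1 f z * (w - z) =
  - (derive1 f z - (w - z)^-1 * (f w - f z)) * (w - z).
  by rewrite opprB mulrBl mulrAC mulVf// mul1r.
by rewrite normcM normcN ler_wpM2r ?normc_ge0.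
Qed.

Lemma cdiff_derivable f z d : cdiff f z d -> derivable f z 1.
Proof.
move=> df; apply/cvg_ex; exists d.
apply/cvgrPdist_le => /= e' /pos_complex[-> e0]; set e := Re e' in e0 *.
apply/nbhs_normcP.
have [r r0 H] := df _ e0.
exists r => // h; rewrite subr0 => hr h0.
have := H (h + z); rewrite addrK => /(_ hr).
rewrite -[h *: 1]/(h * 1) mulr1 normcE_norm lecR -[_ *: (_ - _)]/(_ * _) => Hw.
have h0' : 0 < normc h by rewrite normc_gt0.
rewrite -(ler_pM2r h0'); apply: le_trans Hw.
rewrite -normcM normcB mulrBl mulrAC mulVf// mul1r opprB; lra.
Qed.
End Modulus.
Arguments normc : simpl never.

(** * Integrals of complex-valued functions on segments *)

Section PathIntegral.
Context {R : realType}.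
Implicit Types (u v : R -> R[i]) (a b c t : R).
Notation mu := (@lebesgue_measure R).

Definition ccont u t := forall e, 0 < e ->
  exists2 r : R, 0 < r & forall t', `|t' - t| < r -> normc (u t' - u t) <= e.

(** The set [[a, b]] carries no orientation, so this is a path integral only for [a <= b]; reversed
    sides of a contour get an explicit minus sign. *)
Definition cint u a b : R[i] :=
  (\int[mu]_(t in `[a, b]) Re (u t)) +i* (\int[mu]_(t in `[a, b]) Im (u t)).

Definition icont u a b := forall t, a <= t <= b -> ccont u t.

Lemma ccont_Re u t : ccont u t -> {for t, continuous (fun x => Re (u x))}.
Proof.
move=> uc; apply/cvgrPdist_le => /= e e0.
have [r r0 H] := uc _ e0.
apply/nbhs_ballP; exists r => // s /=; rewrite /ball /= distrC => /H Hs.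
by rewrite distrC -cReN -cReD; apply: le_trans Hs; exact: Re_le_normc.
Qed.

Lemma ccont_Im u t : ccont u t -> {for t, continuous (fun x => Im (u x))}.
Proof.
move=> uc; apply/cvgrPdist_le => /= e e0.
have [r r0 H] := uc _ e0.
apply/nbhs_ballP; exists r => // s /=; rewrite /ball /= distrC => /H Hs.
by rewrite distrC -cImN -cImD; apply: le_trans Hs; exact: Im_le_normc.
Qed.

Lemma icont_integrable (F : R -> R) a b :
  (forall t, a <= t <= b -> {for t, continuous F}) ->
  mu.-integrable `[a, b] (EFin \o F).
Proof.
move=> Fc; apply: continuous_compact_integrable; first exact: segment_compact.
apply: continuous_in_subspaceT => t; rewrite inE /= in_itv /= => tab.
exact: Fc.
Qed.

Lemma icont_Re u a b : icont u a b ->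
  mu.-integrable `[a, b] (EFin \o (fun t => Re (u t))).
Proof. by move=> uc; apply: icont_integrable => t /uc; exact: ccont_Re. Qed.

Lemma icont_Im u a b : icont u a b ->
  mu.-integrable `[a, b] (EFin \o (fun t => Im (u t))).
Proof. by move=> uc; apply: icont_integrable => t /uc; exact: ccont_Im. Qed.

Lemma icont_sub u a b a' b' : a <= a' -> b' <= b -> icont u a b -> icont u a' b'.
Proof.
move=> aa bb uc t /andP[at' tb]; apply: uc.
by rewrite (le_trans aa at') (le_trans tb bb).
Qed.

Lemma Rint_chasles (F : R -> R) a b c : a <= b -> b <= c ->
  mu.-integrable `[a, c] (EFin \o F) ->
  \int[mu]_(t in `[a, c]) F t =
  \int[mu]_(t in `[a, b]) F t + \int[mu]_(t in `[b, c]) F t.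
Proof.
move=> ab bc Fi.
have := @Rintegral_itvB R F (BLeft a) (BRight c) b Fi.
rewrite !bnd_simp => /(_ ab bc).
rewrite Rintegral_itv_obnd_cbnd; first by move=> <-; rewrite addrC subrK.
apply: integrableS Fi => //; apply: subset_itv; rewrite ?bnd_simp//.
Qed.

Lemma cint_chasles u a b c : a <= b -> b <= c -> icont u a c ->
  cint u a c = cint u a b + cint u b c.
Proof.
move=> ab bc uc; rewrite /cint (Rint_chasles ab bc (icont_Re uc)).
by rewrite (Rint_chasles ab bc (icont_Im uc)).
Qed.

Lemma cint_ext u v a b : (forall t, a <= t <= b -> u t = v t) ->
  cint u a b = cint v a b.
Proof.
move=> uv; congr (_ +i* _); apply: eq_Rintegral => t;
  by rewrite inE /= in_itv /= => /uv ->.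
Qed.

Lemma ccontD u v t : ccont u t -> ccont v t -> ccont (fun x => u x + v x) t.
Proof.
move=> uc vc e e0; have e20 : 0 < e / 2 by rewrite divr_gt0.
have [r r0 H] := uc _ e20; have [s s0 H'] := vc _ e20.
exists (Num.min r s) => [|x]; first by rewrite lt_min r0.
rewrite lt_min => /andP[/H Hu /H' Hv].
rewrite opprD addrACA; apply: le_trans (le_normcD _ _) _.
by rewrite (splitr e) lerD.
Qed.

Lemma ccontZ k u t : ccont u t -> ccont (fun x => k * u x) t.
Proof.
move=> uc e e0.
have n0 : 0 < normc k + 1 by rewrite ltr_wpDl// normc_ge0.
have [r r0 H] := uc _ (divr_gt0 e0 n0).
exists r => // x /H Hx; rewrite -mulrBr normcM.
have Hk : normc k * (e / (normc k + 1)) <= e.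
  rewrite mulrCA ler_piMr ?(ltW e0)// ler_pdivrMr// mul1r lerDl//.
apply: le_trans Hk; apply: ler_wpM2l => //; exact: normc_ge0.
Qed.

Lemma cintD u v a b : icont u a b -> icont v a b ->
  cint (fun x => u x + v x) a b = cint u a b + cint v a b.
Proof.
move=> uc vc; rewrite /cint.
rewrite -[RHS]/(_ +i* _) -RintegralD//; try exact: icont_Re.
rewrite -RintegralD//; try exact: icont_Im.
by congr (_ +i* _); apply: eq_Rintegral => t _; rewrite ?cReD ?cImD.
Qed.

Lemma cintZ k u a b : icont u a b ->
  cint (fun x => k * u x) a b = k * cint u a b.
Proof.
move=> uc; rewrite /cint; case: k => p q.
have H1 := icont_Re uc; have H2 := icont_Im uc.
rewrite -[RHS]/((_ - _) +i* (_ + _)) -!RintegralZl//.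
rewrite -RintegralB//; [|exact: (integrableZl _ _ H1)|exact: (integrableZl _ _ H2)].
rewrite -RintegralD//; [|exact: (integrableZl _ _ H2)|exact: (integrableZl _ _ H1)].
by congr (_ +i* _); apply: eq_Rintegral => t _; rewrite ?cReM ?cImM.
Qed.

Lemma fine_mu_itv a b : a <= b -> fine (mu `[a, b]) = b - a.
Proof.
rewrite lebesgue_measure_itv /= lte_fin le_eqVlt => /predU1P[->|->] //.
by rewrite ltxx subrr.
Qed.

Lemma Rint_le (F : R -> R) B a b : a <= b ->
  mu.-integrable `[a, b] (EFin \o F) ->
  (forall t, a <= t <= b -> F t <= B) ->
  \int[mu]_(t in `[a, b]) F t <= B * (b - a).
Proof.
move=> ab Fi FB.
rewrite -(fine_mu_itv ab) -Rintegral_cst//; apply: le_Rintegral => //.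
- apply: continuous_compact_integrable; [exact: segment_compact|by move=> ?;
  exact: cvg_cst].
Qed.

Lemma Rint_norm_le (F : R -> R) B a b : a <= b ->
  mu.-integrable `[a, b] (EFin \o F) ->
  (forall t, a <= t <= b -> `|F t| <= B) ->
  `|\int[mu]_(t in `[a, b]) F t| <= B * (b - a).
Proof.
move=> ab Fi FB; apply: le_trans (le_normr_Rintegral _ Fi) _ => //.
apply: Rint_le => //.
by have := integrable_norm Fi.
Qed.

(** The factor 2 is the price of bounding real and imaginary parts separately. Later constants
    inherit it; only smallness matters there. *)
Lemma cint_bound u B a b : a <= b -> icont u a b ->
  (forall t, a <= t <= b -> normc (u t) <= B) ->
  normc (cint u a b) <= 2 * (B * (b - a)).
Proof.
move=> ab uc uB; apply: le_trans (normc_le_ReIm _) _ => /=.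
have H1 : `|\int[mu]_(t in `[a, b]) Re (u t)| <= B * (b - a).
  apply: Rint_norm_le => //; first exact: icont_Re.
  by move=> t /uB; apply: le_trans; exact: Re_le_normc.
have H2 : `|\int[mu]_(t in `[a, b]) Im (u t)| <= B * (b - a).
  apply: Rint_norm_le => //; first exact: icont_Im.
  by move=> t /uB; apply: le_trans; exact: Im_le_normc.
lra.
Qed.

Lemma Rint_ge (F : R -> R) B a b : a <= b ->
  mu.-integrable `[a, b] (EFin \o F) ->
  (forall t, a <= t <= b -> B <= F t) ->
  B * (b - a) <= \int[mu]_(t in `[a, b]) F t.
Proof.
move=> ab Fi FB.
have H := @Rint_le (fun x => -1 * F x) (- B) a b ab.
rewrite -lerN2 -mulNr; have := H _ _; rewrite RintegralZl// mulN1r; apply.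
  exact: (integrableZl _ _ Fi).
by move=> t /FB; rewrite mulN1r lerN2.
Qed.

Lemma Rint_cst (B : R) a b : a <= b -> \int[mu]_(t in `[a, b]) B = B * (b - a).
Proof.
by move=> ab; rewrite Rintegral_cst// (fine_mu_itv ab).
Qed.

Lemma Rint_id a b : a <= b -> \int[mu]_(t in `[a, b]) t = (b ^+ 2 - a ^+ 2) / 2.
Proof.
rewrite le_eqVlt => /predU1P[->|ab].
  by rewrite set_itv1 Rintegral_set1 subrr mul0r.
rewrite /Rintegral (@continuous_FTC2 _ _ (fun x => x ^+ 2 / 2)) ?fineK//=.
- by rewrite -mulrBl.
- by apply: continuous_subspaceT => x; exact: cvg_id.
- have cF : continuous (fun x : R => x ^+ 2 / 2).
    move=> x; apply: differentiable_continuous; apply/derivable1_diffP.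
    by apply: derivableM => //; exact: derivableX.
  split.
  + by move=> x _; apply: derivableM => //; exact: derivableX.
  + by apply: cvg_at_right_filter; exact: cF.
  + by apply: cvg_at_left_filter; exact: cF.
- move=> x _; rewrite derive1E deriveM//= derive_cst scaler0 add0r.
  rewrite exp_derive /= -[_ *: _]/(_ * _) -[_ *: _]/(_ * _) expr1 mulr1 mulrA.
  by rewrite mulVf ?mul1r// pnatr_eq0.
Qed.

Lemma ccont_cst k t : ccont (fun=> k) t.
Proof. by move=> e e0; exists 1 => // x _; rewrite subrr normc0 ltW. Qed.

Lemma ccont_real t : ccont (fun x => x%:C) t.
Proof.
by move=> e e0; exists e => // x /ltW; rewrite -rmorphB normc_real.
Qed.

Lemma cint_cst k a b : a <= b -> cint (fun=> k) a b = k * (b - a)%:C.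
Proof.
by move=> ab; case: k => p q; rewrite /cint /= !Rint_cst// ; simpc.
Qed.

Lemma cint_real a b : a <= b ->
  cint (fun x => x%:C) a b = ((b ^+ 2 - a ^+ 2) / 2)%:C.
Proof.
by move=> ab; rewrite /cint /= Rint_id// Rint_cst// mul0r.
Qed.

Lemma cint_point u a : cint u a a = 0.
Proof. by rewrite /cint set_itv1 !Rintegral_set1. Qed.

End PathIntegral.
Arguments cint : simpl never.

(** * Goursat's lemma for rectangles *)

Section Goursat.
Context {R : realType}.
Implicit Types (h : R[i] -> R[i]) (a b c d x y l m : R) (A B z w : R[i]).

(** Integrals of h dz along horizontal and vertical segments; the factor i in [ver] is dz/dt. With
    these, [rect] is the counterclockwise contour integral. *)
Definition hor h y a b := cint (fun t => h (t +i* y)) a b.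
Definition ver h x c d := 'i%C * cint (fun t => h (x +i* t)) c d.
Definition rect h a b c d :=
  hor h c a b + ver h b c d - hor h d a b - ver h a c d.

Definition ccontC h z := forall e, 0 < e ->
  exists2 r : R, 0 < r & forall w, normc (w - z) < r -> normc (h w - h z) <= e.

Definition cdiffable h z := exists D, cdiff h z D.

Arguments hor : simpl never.
Arguments ver : simpl never.
Arguments rect : simpl never.

Definition contr h a b c d :=
  forall x y, a <= x <= b -> c <= y <= d -> ccontC h (x +i* y).

Lemma cdiff_cont h z : cdiffable h z -> ccontC h z.
Proof.
move=> [D hD] e e0; have [r r0 H] := hD 1 ltr01.
have n0 : 0 < normc D + 1 by rewrite ltr_wpDl// normc_ge0.
exists (Num.min r (e / (normc D + 1))).
  by rewrite lt_min r0 divr_gt0.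
move=> w; rewrite lt_min ltr_pdivlMr// => /andP[/H]; rewrite mul1r => Hw we.
apply: le_trans (normc_le_sum _ (D * (w - z))) _.
rewrite normcM; lra.
Qed.

Lemma ccont_hor h x y : ccontC h (x +i* y) -> ccont (fun t => h (t +i* y)) x.
Proof.
move=> hc e /hc[r r0 H]; exists r => // t tx; apply: H.
rewrite -[_ - _]/((t - x) +i* (y - y)) subrr.
by rewrite -[_ +i* _]/((t - x)%:C) normc_real.
Qed.

Lemma ccont_ver h x y : ccontC h (x +i* y) -> ccont (fun t => h (x +i* t)) y.
Proof.
move=> hc e /hc[r r0 H]; exists r => // t tx; apply: H.
rewrite -[_ - _]/((x - x) +i* (t - y)) subrr.
by rewrite /normc /= expr0n add0r sqrtr_sqr.
Qed.

Lemma contr_hor h a b c d y : c <= y <= d -> contr h a b c d ->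
  icont (fun t => h (t +i* y)) a b.
Proof. by move=> yc hc t tab; apply: ccont_hor; exact: hc. Qed.

Lemma contr_ver h a b c d x : a <= x <= b -> contr h a b c d ->
  icont (fun t => h (x +i* t)) c d.
Proof. by move=> xc hc t tab; apply: ccont_ver; exact: hc. Qed.

(** Only the four one-variable restrictions to the sides: enough for linearity and bounds of [rect],
    also when h is wild inside. Subdivision uses inner segments and asks for [contr]. *)
Definition bcontr h a b c d :=
  [/\ icont (fun t => h (t +i* c)) a b, icont (fun t => h (t +i* d)) a b,
      icont (fun t => h (a +i* t)) c d & icont (fun t => h (b +i* t)) c d].

Lemma contr_bcontr h a b c d : a <= b -> c <= d -> contr h a b c d ->
  bcontr h a b c d.
Proof.
move=> ab cd hc; split.
- by apply: contr_hor hc; rewrite lexx.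
- by apply: contr_hor hc; rewrite lexx cd.
- by apply: contr_ver hc; rewrite lexx.
- by apply: contr_ver hc; rewrite lexx ab.
Qed.

Lemma rectD h1 h2 a b c d : bcontr h1 a b c d -> bcontr h2 a b c d ->
  rect (fun w => h1 w + h2 w) a b c d = rect h1 a b c d + rect h2 a b c d.
Proof.
by move=> [? ? ? ?] [? ? ? ?]; rewrite /rect /hor /ver !cintD//; ring.
Qed.

Lemma rectZ k h a b c d : bcontr h a b c d ->
  rect (fun w => k * h w) a b c d = k * rect h a b c d.
Proof. by move=> [? ? ? ?]; rewrite /rect /hor /ver !cintZ//; ring. Qed.

Lemma cint_affine A B a b : a <= b ->
  cint (fun t => A + B * t%:C) a b =
  A * (b - a)%:C + B * ((b ^+ 2 - a ^+ 2) / 2)%:C.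
Proof.
move=> ab; rewrite (@cintD _ (fun=> A) (fun t => B * t%:C)).
- rewrite cint_cst// (@cintZ _ B (fun t => t%:C)) ?cint_real//.
  by move=> t _; exact: ccont_real.
- by move=> t _; exact: ccont_cst.
- by move=> t _; apply: ccontZ; exact: ccont_real.
Qed.

Lemma rect_affine A B a b c d : a <= b -> c <= d ->
  rect (fun w => A + B * w) a b c d = 0.
Proof.
move=> ab cd; rewrite /rect /hor /ver.
have H y : cint (fun t => A + B * (t +i* y)) a b =
    (A + B * ('i%C * y%:C)) * (b - a)%:C + B * ((b ^+ 2 - a ^+ 2) / 2)%:C.
  rewrite -cint_affine//; apply: cint_ext => t _.
  by rewrite [t +i* y]complexE /=; ring.
have V x : cint (fun t => A + B * (x +i* t)) c d =
    (A + B * x%:C) * (d - c)%:C + (B * 'i%C) * ((d ^+ 2 - c ^+ 2) / 2)%:C.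
  rewrite -cint_affine//; apply: cint_ext => t _.
  by rewrite [x +i* t]complexE /=; ring.
rewrite !H !V !rmorphB; ring.
Qed.

Definition on_boundary a b c d x y :=
  [/\ a <= x <= b, c <= y <= d & [\/ x = a, x = b, y = c | y = d]].

Lemma rect_bound h (B : R) a b c d : a <= b -> c <= d -> bcontr h a b c d ->
  (forall x y, on_boundary a b c d x y -> normc (h (x +i* y)) <= B) ->
  normc (rect h a b c d) <= 4 * B * ((b - a) + (d - c)).
Proof.
move=> ab cd [hc1 hc2 hc3 hc4] hB; rewrite /rect.
have aa : a <= a <= b by rewrite lexx.
have bb : a <= b <= b by rewrite lexx ab.
have cc : c <= c <= d by rewrite lexx.
have dd : c <= d <= d by rewrite lexx cd.
have n1 : normc 'i%C = 1 :> R by rewrite /normc /= expr0n expr1n add0r sqrtr1.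
have H1 : normc (hor h c a b) <= 2 * (B * (b - a)).
  by apply: cint_bound => // t tab; apply: hB; split=> //; constructor 3.
have H2 : normc (hor h d a b) <= 2 * (B * (b - a)).
  by apply: cint_bound => // t tab; apply: hB; split=> //; constructor 4.
have V1 : normc (ver h a c d) <= 2 * (B * (d - c)).
  rewrite normcM n1 mul1r.
  by apply: cint_bound => // t tab; apply: hB; split=> //; constructor 1.
have V2 : normc (ver h b c d) <= 2 * (B * (d - c)).
  rewrite normcM n1 mul1r.
  by apply: cint_bound => // t tab; apply: hB; split=> //; constructor 2.
have H3 := normcD_le (hor h c a b + ver h b c d - hor h d a b) (- ver h a c d).
have H4 := normcD_le (hor h c a b + ver h b c d) (- hor h d a b).
have H5 := normcD_le (hor h c a b) (ver h b c d).
rewrite !normcN in H3 H4; lra.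
Qed.

Lemma rect_splitx h a m b c d : a <= m -> m <= b -> c <= d ->
  contr h a b c d -> rect h a b c d = rect h a m c d + rect h m b c d.
Proof.
move=> am mb cd hc; rewrite /rect /hor.
rewrite (cint_chasles am mb); last by apply: contr_hor hc; rewrite lexx.
rewrite (@cint_chasles _ (fun t => h (t +i* d)) _ _ _ am mb); last first.
  by apply: contr_hor hc; rewrite lexx cd.
ring.
Qed.

Lemma rect_splity h a b c m d : a <= b -> c <= m -> m <= d ->
  contr h a b c d -> rect h a b c d = rect h a b c m + rect h a b m d.
Proof.
move=> ab cm md hc; rewrite /rect /ver.
rewrite (cint_chasles cm md); last by apply: contr_ver hc; rewrite lexx ab.
rewrite (@cint_chasles _ (fun t => h (a +i* t)) _ _ _ cm md); last first.
  by apply: contr_ver hc; rewrite lexx ab.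
ring.
Qed.

Lemma contr_sub h a b c d a' b' c' d' : a <= a' -> b' <= b -> c <= c' -> d' <= d ->
  contr h a b c d -> contr h a' b' c' d'.
Proof.
move=> aa bb cc dd hc x y /andP[x1 x2] /andP[y1 y2]; apply: hc.
  by rewrite (le_trans aa x1) (le_trans x2 bb).
by rewrite (le_trans cc y1) (le_trans y2 dd).
Qed.

Lemma nested_point (u l : nat -> R) :
  (forall n, u n <= u n.+1) -> (forall n, u n.+1 + l n.+1 <= u n + l n) ->
  (forall n, 0 <= l n) -> exists p, forall n, u n <= p <= u n + l n.
Proof.
move=> uD ulD l0.
have ud (m n : nat) : (m <= n)%N -> u m <= u n.
  by move=> /subnK <-; elim: (n - m)%N => // k IH; exact: le_trans IH (uD _).
have uld (m n : nat) : (m <= n)%N -> u n + l n <= u m + l m.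
  by move=> /subnK <-; elim: (n - m)%N => // k IH; exact: le_trans (ulD _) IH.
have ub n : ubound (range u) (u n + l n).
  move=> _ [k _ <-]; case: (leqP k n) => kn.
    by apply: le_trans (ud _ _ kn) _; rewrite lerDl.
  by apply: le_trans (uld _ _ (ltnW kn)); rewrite lerDl.
exists (sup (range u)) => n; apply/andP; split.
  by apply: ub_le_sup; [exists (u 0%N + l 0%N); exact: ub|exists n].
by apply: ge_sup; [exists (u 0%N); exists 0%N|exact: ub].
Qed.

(** If P fails on a rectangle, it fails on one of its quarters; the failing quarters shrink to a
    point (p, q), where the local hypothesis refutes them. P sees a rectangle through its lower left
    corner and its generation n. With [m = 0] this is bisection of an interval. *)
Lemma bisection (P : R -> R -> nat -> Prop) x0 y0 l m : 0 <= l -> 0 <= m ->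
  let ln n := l / 2 ^+ n in let mn n := m / 2 ^+ n in
  (forall x y n, P x y n.+1 -> P (x + ln n.+1) y n.+1 ->
     P x (y + mn n.+1) n.+1 -> P (x + ln n.+1) (y + mn n.+1) n.+1 -> P x y n) ->
  (forall p q, x0 <= p <= x0 + l -> y0 <= q <= y0 + m ->
    exists2 r, 0 < r & forall x y n, x <= p <= x + ln n -> y <= q <= y + mn n ->
       ln n < r -> mn n < r -> P x y n) ->
  P x0 y0 0%N.
Proof.
move=> l0 m0 ln mn step loc; apply: contrapT => nP.
have lnS n : ln n = ln n.+1 + ln n.+1.
  by rewrite /ln exprS invfM; field; rewrite expf_neq0// pnatr_eq0.
have mnS n : mn n = mn n.+1 + mn n.+1.
  by rewrite /mn exprS invfM; field; rewrite expf_neq0// pnatr_eq0.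
have ln0 n : 0 <= ln n by rewrite divr_ge0// exprn_ge0.
have mn0 n : 0 <= mn n by rewrite divr_ge0// exprn_ge0.
(* The failure of P is a premise under the existential, so that [choice] yields a successor function
   on all states, which can then be iterated. *)
have H (k : nat * (R * R)) : exists k' : nat * (R * R), ~ P k.2.1 k.2.2 k.1 ->
    [/\ k'.1 = k.1.+1, ~ P k'.2.1 k'.2.2 k'.1,
     k.2.1 <= k'.2.1 <= k.2.1 + ln k.1.+1 & k.2.2 <= k'.2.2 <= k.2.2 + mn k.1.+1].
  case: k => n [x y] /=.
  have [?|np] := pselect (P x y n); first by exists (n, (x, y)).
  have [n1|p1] := pselect (~ P x y n.+1).
    by exists (n.+1, (x, y)) => _ /=; split=> //; rewrite ?lexx ?lerDl ?ln0 ?mn0.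
  have [n2|p2] := pselect (~ P (x + ln n.+1) y n.+1).
    by exists (n.+1, (x + ln n.+1, y)) => _ /=; split=> //;
      rewrite ?lexx ?lerDl ?ln0 ?mn0.
  have [n3|p3] := pselect (~ P x (y + mn n.+1) n.+1).
    by exists (n.+1, (x, y + mn n.+1)) => _ /=; split=> //;
      rewrite ?lexx ?lerDl ?ln0 ?mn0.
  have [n4|p4] := pselect (~ P (x + ln n.+1) (y + mn n.+1) n.+1).
    by exists (n.+1, (x + ln n.+1, y + mn n.+1)) => _ /=; split=> //;
       rewrite ?lexx ?lerDl ?ln0 ?mn0.
  by exfalso; apply/np/step; exact: contrapT.
have [F HF] := choice H.
pose s n := iter n F (0%N, (x0, y0)).
have Hs n : (s n).1 = n /\ ~ P (s n).2.1 (s n).2.2 n.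
  elim: n => [|n [IH1 IH2]] //=.
  by have := HF (s n); rewrite IH1 => /(_ IH2)[E Q _ _]; split=> //; rewrite E in Q.
have Hx n : (s n).2.1 <= (s n.+1).2.1 <= (s n).2.1 + ln n.+1.
  by have [E1 E2] := Hs n; have := HF (s n); rewrite E1 => /(_ E2)[].
have Hy n : (s n).2.2 <= (s n.+1).2.2 <= (s n).2.2 + mn n.+1.
  by have [E1 E2] := Hs n; have := HF (s n); rewrite E1 => /(_ E2)[].
have [p Hp] : exists p, forall n, (s n).2.1 <= p <= (s n).2.1 + ln n.
  apply: (@nested_point (fun n => (s n).2.1) ln) => // n.
    by case/andP: (Hx n).
  by case/andP: (Hx n) => _ ?; rewrite (lnS n) addrA lerD2r.
have [q Hq] : exists q, forall n, (s n).2.2 <= q <= (s n).2.2 + mn n.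
  apply: (@nested_point (fun n => (s n).2.2) mn) => // n.
    by case/andP: (Hy n).
  by case/andP: (Hy n) => _ ?; rewrite (mnS n) addrA lerD2r.
have := loc p q; have := Hp 0%N; have := Hq 0%N.
rewrite /ln /mn expr0 !divr1 /= => -> -> /(_ isT isT)[r r0 Hr].
have [n Hn] : exists n, (l + m) / 2 ^+ n < r.
  have lm0 : 0 <= l + m by rewrite addr_ge0.
  exists (Num.bound ((l + m) / r)).
  rewrite ltr_pdivrMr ?exprn_gt0// mulrC -ltr_pdivrMr//.
  apply: lt_trans (archi_boundP _) _; first by rewrite divr_ge0// ltW.
  by rewrite -natrX ltr_nat ltn_expl.
have [_ []] := Hs n; apply: Hr => //.
  by apply: le_lt_trans Hn; rewrite ler_pM2r ?invr_gt0 ?exprn_gt0// lerDl.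
by apply: le_lt_trans Hn; rewrite ler_pM2r ?invr_gt0 ?exprn_gt0// lerDr.
Qed.

Lemma ccontCD h1 h2 z : ccontC h1 z -> ccontC h2 z ->
  ccontC (fun w => h1 w + h2 w) z.
Proof.
move=> uc vc e e0; have e20 : 0 < e / 2 by rewrite divr_gt0.
have [r r0 H] := uc _ e20; have [s s0 H'] := vc _ e20.
exists (Num.min r s) => [|x]; first by rewrite lt_min r0.
rewrite lt_min => /andP[/H Hu /H' Hv].
rewrite opprD addrACA; apply: le_trans (normcD_le _ _) _.
by rewrite (splitr e) lerD.
Qed.

Lemma ccontC_affine A B z : ccontC (fun w => A + B * w) z.
Proof.
apply: cdiff_cont; exists B => e e0; exists 1 => // w _.
have -> : A + B * w - (A + B * z) - B * (w - z) = 0 by ring.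
by rewrite normc0 mulr_ge0 ?normc_ge0 ?ltW.
Qed.

Lemma normc_eq0_eps z (C : R) : 0 <= C ->
  (forall e, 0 < e -> normc z <= e * C) -> z = 0.
Proof.
move=> C0 H; apply: eq0_normc; apply/eqP; rewrite eq_le normc_ge0 andbT.
apply/ler_addgt0Pl => e e0; rewrite addr0.
have C1 : 0 < C + 1 by rewrite ltr_wpDl.
apply: le_trans (H _ (divr_gt0 e0 C1)) _.
by rewrite mulrAC ler_pdivrMr// ler_pM2l// lerDl.
Qed.

(** The tolerance e times the squared half-perimeter is exactly additive over quarters, so it passes
    from the quarters to the whole. On a small rectangle around z the tangent affine map integrates
    to 0, and the remainder is small relative to the distance from z. *)
Theorem goursat h a b c d : a <= b -> c <= d ->
  (forall x y, a <= x <= b -> c <= y <= d -> cdiffable h (x +i* y)) ->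
  rect h a b c d = 0.
Proof.
move=> ab cd hd; set S := (b - a) + (d - c).
have hc : contr h a b c d by move=> x y xab ycd; apply: cdiff_cont; exact: hd.
have l0 : 0 <= b - a by rewrite subr_ge0.
have m0 : 0 <= d - c by rewrite subr_ge0.
apply: (@normc_eq0_eps _ (S ^+ 2)) => [|e e0]; first by rewrite sqr_ge0.
pose ln n := (b - a) / 2 ^+ n; pose mn n := (d - c) / 2 ^+ n.
have ln0 n : 0 <= ln n by rewrite divr_ge0// exprn_ge0.
have mn0 n : 0 <= mn n by rewrite divr_ge0// exprn_ge0.
have lnS n : ln n = ln n.+1 + ln n.+1.
  by rewrite /ln exprS invfM; field; rewrite expf_neq0// pnatr_eq0.
have mnS n : mn n = mn n.+1 + mn n.+1.
  by rewrite /mn exprS invfM; field; rewrite expf_neq0// pnatr_eq0.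
(* Containment in the large rectangle is part of P because [bisection] quantifies over all
   corners. *)
pose P x y n := a <= x -> x + ln n <= b -> c <= y -> y + mn n <= d ->
  normc (rect h x (x + ln n) y (y + mn n)) <= e * (ln n + mn n) ^+ 2.
have abE : a + (b - a) = b by rewrite addrC subrK.
have cdE : c + (d - c) = d by rewrite addrC subrK.
suff: P a c 0%N.
  by rewrite /P /ln /mn expr0 !divr1 abE cdE -/S; apply.
apply: (@bisection P a c (b - a) (d - c)) => //.
  move=> x y n; rewrite -/(ln _) -/(mn _) => P1 P2 P3 P4 ax xb cy yd.
  rewrite (lnS n) addrA in xb; rewrite (mnS n) addrA in yd.
  have := ln0 n.+1; have := mn0 n.+1 => M0 L0.
  have xl : a <= x + ln n.+1 by rewrite (le_trans ax)// lerDl.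
  have yl : c <= y + mn n.+1 by rewrite (le_trans cy)// lerDl.
  have xr : x + ln n.+1 <= b by apply: le_trans xb; rewrite lerDl.
  have yr : y + mn n.+1 <= d by apply: le_trans yd; rewrite lerDl.
  have hs : contr h x (x + ln n.+1 + ln n.+1) y (y + mn n.+1 + mn n.+1).
    exact: contr_sub hc.
  have Q1 := P1 ax xr cy yr; have Q2 := P2 xl xb cy yr.
  have Q3 := P3 ax xr yl yd; have Q4 := P4 xl xb yl yd.
  rewrite (lnS n) (mnS n) !addrA.
  have xx : x <= x + ln n.+1 + ln n.+1 by rewrite -addrA lerDl addr_ge0.
  rewrite (@rect_splity _ _ _ _ (y + mn n.+1)) ?lerDl//.
  rewrite (@rect_splitx _ _ (x + ln n.+1)) ?lerDl//; last first.
    by apply: contr_sub hs; rewrite ?lerDl.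
  rewrite (@rect_splitx _ _ (x + ln n.+1) _ (y + mn n.+1)) ?lerDl//; last first.
    by apply: contr_sub hs; rewrite ?lerDl.
  set r1 := rect _ _ _ _ _ in Q1 *; set r2 := rect _ _ _ _ _ in Q2 *.
  set r3 := rect _ _ _ _ _ in Q3 *; set r4 := rect _ _ _ _ _ in Q4 *.
  have N1 := normcD_le (r1 + r2) (r3 + r4).
  have N2 := normcD_le r1 r2; have N3 := normcD_le r3 r4.
  apply: le_trans N1 _.
  have -> : e * (ln n.+1 + ln n.+1 + mn n.+1 + mn n.+1) ^+ 2 =
     4 * (e * (ln n.+1 + mn n.+1) ^+ 2) by ring.
  lra.
move=> p q; rewrite abE cdE => pab qcd.
have [D hD] := hd p q pab qcd; set z := p +i* q in hD.
(* The 4 cancels the constant of [rect_bound]. *)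
have e40 : 0 < e / 4 by rewrite divr_gt0.
have [r r0 Hr] := hD _ e40.
exists (r / 2); first by rewrite divr_gt0.
move=> x y n; rewrite -/(ln _) -/(mn _) => /andP[xp px] /andP[yq qy] lr mr.
move=> ax xb cy yd.
pose g w := h w + ((- (h z - D * z)) + (- D) * w).
have hs : contr h x (x + ln n) y (y + mn n) by exact: contr_sub hc.
have ga : contr (fun w => (- (h z - D * z)) + (- D) * w) x (x + ln n) y (y + mn n).
  by move=> s t _ _; exact: ccontC_affine.
have -> : rect h x (x + ln n) y (y + mn n) = rect g x (x + ln n) y (y + mn n).
  rewrite rectD; first by rewrite rect_affine ?lerDl// addr0.
    by apply: contr_bcontr; rewrite ?lerDl.
  by apply: contr_bcontr; rewrite ?lerDl.
apply: le_trans (@rect_bound _ (e / 4 * (ln n + mn n)) _ _ _ _ _ _ _ _) _;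
  rewrite ?lerDl//.
- apply: contr_bcontr; rewrite ?lerDl//.
  by move=> s t sx ty; apply: ccontCD; [exact: hs|exact: ga].
- move=> s t [/andP[xs sx] /andP[yt ty] _].
  have wz : normc (s +i* t - z) <= ln n + mn n.
    apply: le_trans (normc_le_ReIm _) _ => /=.
    by apply: lerD; rewrite ler_norml; apply/andP; split; lra.
  have -> : g (s +i* t) = h (s +i* t) - h z - D * (s +i* t - z).
    by rewrite /g; ring.
  apply: le_trans (Hr _ _) _; first by apply: le_lt_trans wz _; lra.
  by rewrite ler_pM2l.
- by rewrite le_eqVlt; apply/orP; left; apply/eqP; field.
Qed.
End Goursat.
Arguments hor : simpl never.
Arguments ver : simpl never.
Arguments rect : simpl never.

(** * Chain classes of a totally disconnected compact set *)

Section ChainClasses.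
Context {R : realType}.
Variable K : set R[i].
Implicit Types (x y p q v w : R[i]) (delta eta : R).

Lemma nbhs0_right_exists (P : R -> Prop) :
  (\forall d \near 0^'+, P d) -> exists2 d, 0 < d & P d.
Proof.
move=> H.
have /filter_ex[d [d0 Pd]] : \forall d \near (0 : R)^'+, 0 < d /\ P d.
  by near=> d; split; [near: d; exact: nbhs_right_gt|near: d].
by exists d.
Unshelve. all: by end_near. Qed.

Definition chain_closed delta (A : set R[i]) := forall p q,
  A p -> K q -> normc (p - q) < delta -> A q.

(* The points reachable from x along chains in K with steps shorter than delta. *)
Definition chain_class delta x : set R[i] :=
  [set y | forall A : set R[i], A x -> chain_closed delta A -> A y].

Lemma chain_class_refl delta x : chain_class delta x x.
Proof. by []. Qed.

Lemma chain_class_sub delta x : K x -> chain_class delta x `<=` K.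
Proof. by move=> Kx y; apply. Qed.

Lemma chain_class_closed delta x : chain_closed delta (chain_class delta x).
Proof. by move=> p q xp Kq pq A Ax Ac; apply: (Ac p q) => //; exact: xp. Qed.

Lemma chain_class_trans delta x y z : chain_class delta x y ->
  chain_class delta y z -> chain_class delta x z.
Proof. by move=> xy yz A Ax Ac; apply: (yz A) => //; exact: xy. Qed.

(** The complement in [K] of a chain-closed set is again chain-closed, because the step condition is
    symmetric. *)
Lemma chain_class_sym delta x y : K x -> chain_class delta x y ->
  chain_class delta y x.
Proof.
move=> Kx xy A Ay Ac; apply: contrapT => nAx.
have [_] : (K `&` ~` A) y; last by move=> nA; exact: nA.
apply: xy => // p q [Kp nAp] Kq pq; split=> // Aq; apply: nAp.
by apply: Ac Aq _ _ => //; rewrite normcB.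
Qed.

Lemma chain_class_mono d1 d2 x : d1 <= d2 ->
  chain_class d1 x `<=` chain_class d2 x.
Proof.
move=> d12 y xy A Ax Ac; apply: xy => // p q Ap Kq pq.
by apply: (Ac p q) => //; exact: lt_le_trans d12.
Qed.

Hypothesis Kcompact : compact K.

Lemma compact_complex_closed : closed K.
Proof. by apply: compact_closed Kcompact; exact: norm_hausdorff. Qed.

(** Compactness as passage from local to uniform scales, by the near-covering property for the
    filter of small positive d. The premise must hold for all nearby points and all smaller scales
    at once. *)
Lemma compact_uniform (B : set R[i]) (P : R[i] -> R -> Prop) : compact B ->
  (forall p, B p -> exists2 r : R, 0 < r &
    forall q d, B q -> normc (q - p) < r -> 0 < d < r -> P q d) ->
  exists2 d : R, 0 < d & forall p, B p -> P p d.
Proof.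
move=> cB H; apply: nbhs0_right_exists.
have := iffLR (compact_near_coveringP B) cB R (0^'+) (fun d q => B q -> P q d).
move=> /(_ _ _)/= Q.
have : \forall d \near (0 : R)^'+, B `<=` (fun q => B q -> P q d).
  apply: Q => q /H[r r0 Hr].
  exists ([set w | normc (w - q) < r], [set d | 0 < d < r]) => /=.
    split; first by apply/nbhs_normcP; exists r.
    near=> e; apply/andP; split=> //.
  by case=> w e /= [wq er] Bw; exact: Hr.
by apply: filterS => d Hd p Bp; exact: Hd.
Unshelve. all: by end_near. Qed.

(** In a compact metric space this is the connected component of x. The inclusion in the component
    is the one established below, via connectedness. *)
Let core x : set R[i] := [set y | forall delta, 0 < delta -> chain_class delta x y].

(** A point p of [K] outside G is missed by the class of x at some scale e. A point within e of p
    that is reached at a scale below e would carry the chain on to p; so near p all finer classes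
    are empty, and compactness of [K] minus G makes the scale uniform. *)
Lemma chain_class_in_open x (G : set R[i]) : open G ->
  (forall y, (forall delta, 0 < delta -> chain_class delta x y) -> G y) -> K x ->
  exists2 delta, 0 < delta & chain_class delta x `<=` G.
Proof.
move=> oG CG Kx.
have cKG : compact (K `&` ~` G).
  by apply: compact_closedI => //; exact: open_closedC.
suff [d d0 Hd] : exists2 d : R, 0 < d & forall p, (K `&` ~` G) p -> ~ chain_class d x p.
  exists d => // y xy; apply: contrapT => nGy; apply: (Hd y) => //; split=> //.
  exact: chain_class_sub xy.
apply: compact_uniform => // p [Kp nGp].
have : ~ core x p by move=> /CG.
move=> /existsNP[e] /not_implyP[e0 np]; exists e => // q d [Kq _] qp /andP[d0 de] xq.
apply: np; apply: (chain_class_closed _ Kp qp).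
by apply: chain_class_mono xq; apply: ltW.
Qed.

Lemma core_closed x : K x -> closed (core x).
Proof.
move=> Kx y cy d d0.
have Ky : K y.
  apply: compact_complex_closed; apply: closure_subset cy => z /(_ 1 ltr01).
  exact: chain_class_sub.
have [z [zx]] := cy [set w | normc (w - y) < d] (iffRL (nbhs_normcP _ _) (ex_intro2 _ _
  d d0 (fun w h => h))).
by move=> /= zy; apply: (chain_class_closed (zx d d0)).
Qed.

(** Two separated pieces would be compact, hence at positive distance. Fine chains from x stay in
    small neighbourhoods of the pieces and cannot jump the gap between them, yet points of both
    pieces are reachable at every scale. *)
Lemma core_connected x : K x -> connected (core x).
Proof.
move=> Kx; apply: contrapT => /connectedPn[E [E0 CE [sE1 sE2]]].
have sE b : closure (E b) `&` E (~~ b) = set0 by case: b => //=; rewrite setIC.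
have cE b : compact (E b).
  apply: (subclosed_compact _ Kcompact); last first.
    move=> y Ey; have : core x y by rewrite CE; case: b Ey; [right|left].
    by move=> /(_ 1 ltr01); exact: chain_class_sub.
  move=> y cy.
  have : core x y.
    apply: (core_closed Kx); apply: closure_subset cy => z Ez; rewrite CE.
    by case: b Ez; [right|left].
  rewrite CE => Ey.
  have nE : ~ E (~~ b) y.
    by move=> Eny; have : (closure (E b) `&` E (~~ b)) y by []; rewrite sE.
  by case: b nE {cy} Ey => /= nE [].
have [b Eb] : exists b, E b x.
  have : core x x by move=> d d0; exact: chain_class_refl.
  by rewrite CE => -[]; [exists false|exists true].
have [y Ey] := E0 (~~ b).
(* Of the distance [3 * rho], each neighbourhood uses up [rho], which leaves a gap of [rho] for the
   chain steps. *)
have [rho rho0 Hrho] : exists2 rho : R, 0 < rho &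
    forall p, E b p -> forall q, E (~~ b) q -> 3 * rho <= normc (p - q).
  apply: compact_uniform => // p Ebp.
  have [r r0 Hr] : exists2 r : R, 0 < r & forall q, E (~~ b) q -> r <= normc (p - q).
    apply: contrapT => H.
    have : (closure (E (~~ b)) `&` E (~~ ~~ b)) p.
      split; last by rewrite negbK.
      move=> B /nbhs_normcP[r r0 HB]; apply: contrapT => nB; apply: H.
      exists r => // q Eq; rewrite leNgt; apply/negP => pq; apply: nB.
      by exists q; split=> //; apply: HB; rewrite normcB.
    by rewrite sE.
  exists (r / 6); first by rewrite divr_gt0.
  move=> q d Eq qp /andP[d0 dr] q' Eq'.
  have := Hr _ Eq'; have := normc_triangle p q q'; rewrite (normcB p q); lra.
pose U b := [set p | exists2 q, E b q & normc (p - q) < rho].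
have oU b' : open (U b').
  rewrite openE => p [q Eq pq]; apply/nbhs_normcP; exists (rho - normc (p - q)).
    by rewrite subr_gt0.
  move=> w wp; exists q => //.
  by have := normc_triangle w p q; have : normc (w - p) < rho - normc (p - q) by []; lra.
have [d d0 Hd] : exists2 d, 0 < d & chain_class d x `<=` U false `|` U true.
  apply: chain_class_in_open => //; first exact: openU.
  move=> z Cz; have : core x z by [].
  by rewrite CE => -[Ez|Ez]; [left|right]; exists z => //; rewrite subrr normc0.
pose d' := Num.min d rho.
have d'0 : 0 < d' by rewrite lt_min d0.
have UU p q : U b p -> U (~~ b) q -> rho <= normc (p - q).
  move=> [p' Ep pp] [q' Eq qq]; have := Hrho _ Ep _ Eq.
  have := normc_triangle p' p q'; have := normc_triangle p q q'.
  rewrite (normcB p' p); lra.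
(* Induction along the chain: the part of the class lying in [U b] is itself chain-closed, so it
   contains y, although y lies in the other piece. *)
have Ux : (chain_class d' x `&` U b) y.
  have Cy : core x y by rewrite CE; case: b Ey {Eb UU Hrho}; [left|right].
  apply: (Cy _ d'0); first by split=> //; exists x => //; rewrite subrr normc0.
  move=> p q [xp Up] Kq pq.
  have xq : chain_class d' x q by exact: chain_class_closed pq.
  split=> //.
  have : (U false `|` U true) q.
    by apply: Hd; apply: chain_class_mono xq; rewrite ge_min lexx.
  have nUq : ~ U (~~ b) q.
    move=> Uq; have := UU _ _ Up Uq; rewrite leNgt; apply/negP; rewrite negbK.
    by apply: lt_le_trans pq _; rewrite ge_min lexx orbT.
  by case: b nUq {Eb Ey UU Hrho Up} => /= nUq [].
case: Ux => _ Uy.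
have : U (~~ b) y by exists y => //; rewrite subrr normc0.
by move=> /(UU _ _ Uy); rewrite subrr normc0 leNgt rho0.
Qed.

Hypothesis Ktd : totally_disconnected K.

(** For one x, the core is connected, hence reduced to x, and the classes shrink into a ball of
    radius [eta / 2]. For q near x, the classes of q at finer scales lie in that of x, which costs a
    factor 2 in the radius. *)
Lemma chain_class_small eta : 0 < eta -> exists2 delta, 0 < delta &
  forall x, K x -> forall y, chain_class delta x y -> normc (y - x) <= eta.
Proof.
move=> eta0; apply: compact_uniform => // x Kx.
have [d d0 Hd] : exists2 d, 0 < d &
    chain_class d x `<=` [set y | normc (y - x) < eta / 2].
  apply: chain_class_in_open => //.
    rewrite openE => p /= px; apply/nbhs_normcP; exists (eta / 2 - normc (p - x)).
      by rewrite subr_gt0.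
    by move=> w wp /=; have := normc_triangle w p x; lra.
  move=> y Cy.
  have : connected_component K x y.
    exists (core x) => //; split => //.
    - by move=> d d0; exact: chain_class_refl.
    - by move=> z /(_ 1 ltr01); exact: chain_class_sub.
    - exact: core_connected.
  by rewrite Ktd// => ->; rewrite /= subrr normc0 divr_gt0.
exists d => // q e Kq qx /andP[e0 ed] y qy.
have xq : chain_class d x q.
  by apply: (chain_class_closed (@chain_class_refl d x)) => //; rewrite normcB.
have xy : chain_class d x y.
  by apply: chain_class_trans xq _; apply: chain_class_mono qy; exact: ltW.
have /= := Hd _ xq; have /= := Hd _ xy.
have := normc_triangle y x q; rewrite (normcB x q); lra.
Qed.

(* The form in which total disconnectedness is used: near K, the map r is locally
   constant and eta-close to the identity. *)
Lemma locally_constant_approx eta : 0 < eta ->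
  exists2 delta, 0 < delta & exists r : R[i] -> R[i], forall v v' p p',
    K p -> K p' -> normc (v - p) < delta -> normc (v' - p') < delta ->
    normc (v - v') < delta ->
    [/\ r v = r v', K (r v) & normc (v - r v) <= eta].
Proof.
move=> eta0; have eta20 : 0 < eta / 2 by rewrite divr_gt0.
have [d d0 Hd] := chain_class_small eta20.
pose near v := [set p | K p /\ normc (v - p) < Num.min (d / 3) (eta / 2)].
(* A representative of the class of some point of [K] near v. [xget] sees only the set, so equal
   classes give equal representatives; the default 0 never occurs near [K]. *)
pose r v := xget 0 (chain_class d (xget 0 (near v))).
(* The [d / 3] serves the three steps n, v, v', n', which join the two chosen points by less than d;
   [eta / 2] serves the two steps from v to n and from n to [r v]. *)
exists (Num.min (d / 3) (eta / 2)).
  by rewrite lt_min !divr_gt0.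
exists r => v v' p p' Kp Kp' vp vp' vv.
have near_in w q : K q -> normc (w - q) < Num.min (d / 3) (eta / 2) ->
    near w (xget 0 (near w)).
  by move=> Kq wq; apply: xgetPex; exists q; split.
have [Kn] := near_in _ _ Kp vp; have [Kn'] := near_in _ _ Kp' vp'.
rewrite !lt_min in vv *; set n := xget 0 (near v); set n' := xget 0 (near v').
move=> /andP[v'n' _] /andP[vn vn2].
have nn' : normc (n - n') < d.
  have := normc_triangle n v n'; have := normc_triangle v v' n'.
  by rewrite (normcB n v); case/andP: vv; lra.
have E : chain_class d n = chain_class d n'.
  have cnn : chain_class d n n'.
    exact: (chain_class_closed (@chain_class_refl d n)).
  apply/seteqP; split=> z; last exact: chain_class_trans.
  by apply: chain_class_trans; exact: chain_class_sym.
have rn : chain_class d n (r v) by apply: xgetPex; exists n; exact: chain_class_refl.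
split.
- by rewrite /r -/n -/n' E.
- exact: chain_class_sub rn.
- have := Hd _ Kn _ rn; have := normc_triangle v n (r v).
  by rewrite (normcB n (r v)) -/n; lra.
Qed.
End ChainClasses.

(** * Coverings by squares *)

Section Covering.
Context {R : realType}.
Implicit Types (K A : set R[i]) (p q a w : R[i]).

Definition in_square a (r : R) p :=
  (`|Re p - Re a| < r) /\ (`|Im p - Im a| < r).

Lemma diameter_ge0 A : (0 <= diameter A)%E.
Proof. by apply: ereal_sup_ubound; left. Qed.

Lemma normc_le_diameter A p q : A p -> A q -> ((normc (p - q))%:E <= diameter A)%E.
Proof. by move=> Ap Aq; apply: ereal_sup_ubound; right; exists (p, q). Qed.

Lemma open_square a (r : R) : open [set p | in_square a r p].
Proof.
rewrite openE => p [p1 p2]; apply/nbhs_normcP.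
exists (Num.min (r - `|Re p - Re a|) (r - `|Im p - Im a|)).
  by rewrite lt_min !subr_gt0 p1.
move=> w; rewrite lt_min => /andP[w1 w2]; split.
  have H := Re_le_normc (w - p); rewrite cReD cReN in H.
  have := ler_distD (Re p) (Re w) (Re a); lra.
have H := Im_le_normc (w - p); rewrite cImD cImN in H.
have := ler_distD (Im p) (Im w) (Im a); lra.
Qed.

Lemma sum_half_powers (N : nat) : \sum_(0 <= n < N) (2 : R) ^- n.+1 <= 1.
Proof.
have -> : \sum_(0 <= n < N) (2 : R) ^- n.+1 = 1 - 2 ^- N.
  elim: N => [|N IH]; first by rewrite big_geq// expr0 invr1 subrr.
  rewrite big_nat_recr//= IH exprS invfM.
  by field; rewrite expf_neq0// pnatr_eq0.
by rewrite gerBl invr_ge0 exprn_ge0.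
Qed.

(** A set of the cover that meets [K] lies in a square centred at one of its points in [K], with
    half-side slightly above its diameter; compactness leaves finitely many. What matters is that L
    does not depend on tau. *)
Lemma hausdorff_squares K : compact K -> (hausdorff_measure1 K < +oo)%E ->
  exists L : R, forall tau, 0 < tau -> exists s : seq (R[i] * R),
    [/\ forall ar, ar \in s -> K ar.1 /\ 0 < ar.2 <= tau,
        forall p, K p -> exists2 ar, ar \in s & in_square ar.1 ar.2 p &
        \sum_(ar <- s) ar.2 <= L].
Proof.
move=> cK HK.
have [H HH] : exists H : R, (hausdorff_measure1 K <= H%:E)%E.
  case: (hausdorff_measure1 K) HK => [x _|//|_]; first by exists x.
  by exists 0; rewrite leNye.
(* One unit pays for a cover that is not optimal, the other for enlarging the squares. *)
exists (H + 2) => tau tau0.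
have : (hausdorff_content (tau / 2) K < (H + 1)%:E)%E.
  apply: le_lt_trans (_ : (_ <= H%:E)%E) _; last by rewrite lte_fin ltrDl.
  apply: le_trans HH; apply: ereal_sup_ubound; exists (tau / 2) => //=.
  by rewrite divr_gt0.
move=> /ereal_inf_lt[_ [E [KE Ed] <-] HE].
have dfin n : diameter (E n) \is a fin_num.
  rewrite ge0_fin_numE ?diameter_ge0//; apply: le_lt_trans (Ed n) _.
  exact: ltry.
pose d n := fine (diameter (E n)).
have d0 n : 0 <= d n by apply: fine_ge0; exact: diameter_ge0.
have dE n : diameter (E n) = (d n)%:E by rewrite fineK.
have dtau n : d n <= tau / 2 by rewrite -lee_fin -dE; exact: Ed.
pose e := Num.min (tau / 2) 1.
have e0 : 0 < e by rewrite lt_min divr_gt0//=.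
(* The summable enlargement makes half-sides positive even for sets of diameter 0 and lets open
   squares cover; it adds at most e in total. *)
pose r n := d n + e * 2 ^- n.+1.
pose a n := xget 0 (E n `&` K).
pose D := [set n | E n `&` K !=set0].
have aP n : D n -> (E n `&` K) (a n) by move=> Dn; exact: xgetPex.
have pw n : 0 < (2 : R) ^- n.+1 <= 1.
  rewrite invr_gt0 exprn_gt0//= invf_le1 ?exprn_gt0//.
  by rewrite exprn_ege1// ler1n.
have r0 n : 0 < r n.
  by rewrite ltr_wpDl// mulr_gt0//; case/andP: (pw n).
have rtau n : r n <= tau.
  have : e * 2 ^- n.+1 <= tau / 2.
    have : e <= tau / 2 by rewrite ge_min lexx.
    by apply: le_trans; rewrite ler_piMr ?(ltW e0)//; case/andP: (pw n).
  by rewrite /r; have := dtau n; lra.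
have cov : K `<=` \bigcup_(n in D) [set p | in_square (a n) (r n) p].
  move=> p Kp; have [n _ Ep] := KE p Kp.
  have Dn : D n by exists p.
  have [Ea Ka] := aP n Dn.
  have : normc (p - a n) <= d n by rewrite -lee_fin -dE; exact: normc_le_diameter.
  move=> pa; exists n => //=.
  have dr : d n < r n by rewrite ltrDl mulr_gt0//; case/andP: (pw n).
  have H1 := Re_le_normc (p - a n); rewrite cReD cReN in H1.
  have H2 := Im_le_normc (p - a n); rewrite cImD cImN in H2.
  by split; lra.
move: cK; rewrite compact_cover => /(_ nat D _ _ cov)[|D' D'D cov'].
  by move=> n _; exact: open_square.
have [N HN] : exists N, forall n, n \in D' -> (n < N)%N.
  exists (\max_(n <- D') n)%N.+1 => n nD; rewrite ltnS.
  exact: (@leq_bigmax_seq _ _ xpredT id _ nD isT).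
exists [seq (a n, r n) | n <- index_iota 0 N & `[< D n >]]; split.
- move=> ar /mapP[n]; rewrite mem_filter => /andP[/asboolP Dn _] -> /=.
  by split; [case: (aP n Dn)|rewrite r0 rtau].
- move=> p /cov'[n /= nD' pn]; exists (a n, r n) => //.
  apply/mapP; exists n => //; rewrite mem_filter mem_index_iota HN//= andbT.
  by apply/asboolP; have := D'D _ nD'; rewrite ?inE ?in_setE.
- rewrite big_map big_filter big_mkcond /=.
  apply: (@le_trans _ _ (\sum_(0 <= n < N) r n)).
    by apply: ler_sum => n _; case: ifP => // _; exact: ltW.
  rewrite big_split /= -mulr_sumr.
  have S1 : \sum_(0 <= n < N) d n <= H + 1.
    rewrite -lee_fin; apply: le_trans (ltW HE).
    rewrite -sumEFin.
    under eq_bigr do rewrite -dE.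
    have := @nneseries_lim_ge R (fun n => diameter (E n)) xpredT 0 N.
    apply => n _ _; exact: diameter_ge0.
  have S2 : e * \sum_(0 <= n < N) 2 ^- n.+1 <= 1.
    have e1 : e <= 1 by rewrite ge_min lexx orbT.
    apply: le_trans e1; rewrite ler_piMr ?(ltW e0)//; exact: sum_half_powers.
  lra.
Qed.
End Covering.

(** * Sums over grids *)

Section GridSums.
Context {R : realType}.
Implicit Types (N p q : nat).

(** Discrete Green formula: an inner edge is counted by its two cells with opposite signs. *)
Lemma grid_telescope N (A B : nat -> nat -> R[i]) :
  \sum_(0 <= p < N) \sum_(0 <= q < N)
     (A p q + B p.+1 q - A p q.+1 - B p q) =
  \sum_(0 <= p < N) A p 0%N + \sum_(0 <= q < N) B N q
  - \sum_(0 <= p < N) A p N - \sum_(0 <= q < N) B 0%N q.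
Proof.
have HA p : \sum_(0 <= q < N) (A p q - A p q.+1) = A p 0%N - A p N.
  rewrite -[RHS]opprB -telescope_sumr// -sumrN.
  by apply: eq_bigr => q _; rewrite opprB.
have HB q : \sum_(0 <= p < N) (B p.+1 q - B p q) = B N q - B 0%N q.
  by rewrite telescope_sumr.
transitivity (\sum_(0 <= p < N) \sum_(0 <= q < N) (A p q - A p q.+1) +
   \sum_(0 <= p < N) \sum_(0 <= q < N) (B p.+1 q - B p q)).
  rewrite -big_split; apply: eq_bigr => p _; rewrite -big_split.
  by apply: eq_bigr => q _; rewrite /=; ring.
rewrite [X in _ + X]exchange_big /= (eq_bigr _ (fun p _ => HA p)).
rewrite (eq_bigr _ (fun q _ => HB q)) !big_split /= !sumrN; ring.
Qed.

Lemma normc_sum_le (I : Type) (s : seq I) (P : pred I) (f : I -> R[i]) (w : I -> R) :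
  (forall i, P i -> normc (f i) <= w i) ->
  normc (\sum_(i <- s | P i) f i) <= \sum_(i <- s | P i) w i.
Proof.
move=> H; elim/big_ind2: _ => //; first by rewrite normc0.
by move=> x a y b xa yb; apply: le_trans (normcD_le _ _) _; exact: lerD.
Qed.

(* Inside U the edge values A, B may be replaced by the exact differences
   Ga, Gb, which sum to 0 around each cell, so only the boundary of U counts. *)
Lemma grid_boundary N (A B Ga Gb : nat -> nat -> R[i]) (U : nat -> nat -> bool)
    (w1 w2 w3 w4 : nat -> nat -> R) :
  (forall p q, 0 <= w1 p q) -> (forall p q, 0 <= w2 p q) ->
  (forall p q, 0 <= w3 p q) -> (forall p q, 0 <= w4 p q) ->
  (forall p q, (p < N)%N -> (q < N)%N -> U p q -> ~~ U p q.-1 ->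
     normc (A p q - Ga p q) <= w1 p q) ->
  (forall p q, (p < N)%N -> (q < N)%N -> U p q -> ~~ U p q.+1 ->
     normc (A p q.+1 - Ga p q.+1) <= w2 p q) ->
  (forall p q, (p < N)%N -> (q < N)%N -> U p q -> ~~ U p.-1 q ->
     normc (B p q - Gb p q) <= w3 p q) ->
  (forall p q, (p < N)%N -> (q < N)%N -> U p q -> ~~ U p.+1 q ->
     normc (B p.+1 q - Gb p.+1 q) <= w4 p q) ->
  (forall p q, Ga p q + Gb p.+1 q - Ga p q.+1 - Gb p q = 0) ->
  (forall p q, (p < N)%N -> (q < N)%N -> ~~ U p q ->
     A p q + B p.+1 q - A p q.+1 - B p q = 0) ->
  (forall p, U p 0%N = false) -> (forall p, U p N = false) ->
  (forall q, U 0%N q = false) -> (forall q, U N q = false) ->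
  normc (\sum_(0 <= p < N) A p 0%N + \sum_(0 <= q < N) B N q
    - \sum_(0 <= p < N) A p N - \sum_(0 <= q < N) B 0%N q) <=
  \sum_(0 <= p < N) \sum_(0 <= q < N) (w1 p q + w2 p q + w3 p q + w4 p q).
Proof.
move=> w10 w20 w30 w40 H1 H2 H3 H4 HG H0 Up0 UpN U0q UNq.
(* [A p q] is the lower edge of cell (p, q), shared with cell (p, q.-1); [B p q] is its left edge.
   Only edges with both neighbours in U are replaced, so cells off U and the rim of the grid keep
   their values. At index 0, where [.-1] stays at 0, U is false. *)
pose A' p q := if U p q && U p q.-1 then Ga p q else A p q.
pose B' p q := if U p q && U p.-1 q then Gb p q else B p q.
have -> : \sum_(0 <= p < N) A p 0%N + \sum_(0 <= q < N) B N q
    - \sum_(0 <= p < N) A p N - \sum_(0 <= q < N) B 0%N q =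
  \sum_(0 <= p < N) A' p 0%N + \sum_(0 <= q < N) B' N q
    - \sum_(0 <= p < N) A' p N - \sum_(0 <= q < N) B' 0%N q.
  congr (_ + _ - _ - _); apply: eq_bigr => k _; rewrite /A' /B'.
  - by rewrite Up0.
  - by rewrite UNq.
  - by rewrite UpN.
  - by rewrite U0q.
rewrite -grid_telescope !big_nat; apply: normc_sum_le => p /= pN.
rewrite !big_nat; apply: normc_sum_le => q /= qN.
case: (boolP (U p q)) => Upq; last first.
  rewrite /A' /B' /= (negbTE Upq) !andbF /= H0// normc0.
  by rewrite !addr_ge0.
have -> : A' p q + B' p.+1 q - A' p q.+1 - B' p q =
  (A' p q - Ga p q) + (B' p.+1 q - Gb p.+1 q) + - (A' p q.+1 - Ga p q.+1)
  + - (B' p q - Gb p q).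
  by have := HG p q; move=> E; rewrite -[LHS]subr0 -E; ring.
have N1 : normc (A' p q - Ga p q) <= w1 p q.
  rewrite /A' Upq /=; case: ifPn => [_|]; first by rewrite subrr normc0.
  exact: H1.
have N2 : normc (A' p q.+1 - Ga p q.+1) <= w2 p q.
  rewrite /A' /= Upq andbT; case: ifPn => [_|]; first by rewrite subrr normc0.
  exact: H2.
have N3 : normc (B' p q - Gb p q) <= w3 p q.
  rewrite /B' Upq /=; case: ifPn => [_|]; first by rewrite subrr normc0.
  exact: H3.
have N4 : normc (B' p.+1 q - Gb p.+1 q) <= w4 p q.
  rewrite /B' /= Upq andbT; case: ifPn => [_|]; first by rewrite subrr normc0.
  exact: H4.
set t1 := A' p q - _ in N1 *; set t2 := A' p q.+1 - _ in N2 *.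
set t3 := B' p q - _ in N3 *; set t4 := B' p.+1 q - _ in N4 *.
have D1 := normcD_le (t1 + t4 - t2) (- t3); have D2 := normcD_le (t1 + t4) (- t2).
have D3 := normcD_le t1 t4; rewrite !normcN in D1 D2; lra.
Qed.

Lemma sum_unique_le1 N (b : pred nat) :
  (forall p q, b p -> b q -> p = q) ->
  \sum_(0 <= q < N) ((b q)%:R : R) <= 1.
Proof.
move=> H; elim: N => [|N IH]; first by rewrite big_geq.
rewrite big_nat_recr//=; case: (boolP (b N)) => bN; last by rewrite addr0.
rewrite big_nat big1 ?add0r// => q /= qN.
by case: (boolP (b q)) => // bq; move: qN; rewrite (H _ _ bq bN) ltnn.
Qed.

(** * Grid cells met by an interval *)

Implicit Types (x s u v : R).

Definition gridpt x0 s p := x0 + p%:R * s.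

(** Closed cells against a closed interval: touching counts, so a cell that does not hit avoids the
    interval including its own end points. *)
Definition hits x0 s u v p := (gridpt x0 s p <= v) && (u <= gridpt x0 s p.+1).

Lemma gridptS x0 s p : gridpt x0 s p.+1 = gridpt x0 s p + s.
Proof. by rewrite /gridpt -natr1; ring. Qed.

Lemma gridpt_le x0 s p q : 0 < s -> (p <= q)%N -> gridpt x0 s p <= gridpt x0 s q.
Proof. by move=> s0 pq; rewrite /gridpt lerD2l ler_pM2r// ler_nat. Qed.

(** Cells that hit lie within [[u - s, v + s]]. For the clamp c to that interval, the increments of
    c along the grid are s on these cells and nonnegative elsewhere, and they telescope. *)
Lemma hits_count x0 s u v N : 0 < s -> u <= v ->
  \sum_(0 <= p < N) ((hits x0 s u v p)%:R : R) * s <= (v - u) + 2 * s.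
Proof.
move=> s0 uv; pose X := gridpt x0 s;
  pose c (x : R) := Num.min (Num.max x (u - s)) (v + s).
have cmono x y : x <= y -> c x <= c y.
  move=> xy; rewrite /c le_min !ge_min lexx orbT andbT; apply/orP; left.
  by rewrite ge_max !le_max xy lexx orbT.
have -> : (v - u) + 2 * s = (v + s) - (u - s) by ring.
apply: (@le_trans _ _ (c (X N) - c (X 0%N))); last first.
  apply: lerB; first by rewrite /c ge_min lexx orbT.
  rewrite /c le_min le_max lexx orbT /=; lra.
rewrite -(telescope_sumr (fun p => c (X p)) (leq0n N)); apply: ler_sum => p _.
case: (boolP (hits x0 s u v p)) => [/andP[]|_]; last first.
  by rewrite mul0r subr_ge0; apply: cmono; exact: gridpt_le.
rewrite -/(X p) -/(X p.+1) => m1 m2; rewrite mul1r;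
  have XSp : X p.+1 = X p + s := gridptS _ _ _.
have -> : c (X p) = X p.
  rewrite /c max_l; last by lra.
  by rewrite min_l//; lra.
have -> : c (X p.+1) = X p.+1.
  rewrite /c max_l; last by lra.
  by rewrite min_l//; lra.
lra.
Qed.

(** The cells meeting an interval are consecutive, so the run has a single beginning; [hits_last] is
    the same for its end. *)
Lemma hits_first x0 s u v N : 0 < s -> ~~ hits x0 s u v 0 ->
  \sum_(0 <= q < N) ((hits x0 s u v q && ~~ hits x0 s u v q.-1)%:R : R) <= 1.
Proof.
move=> s0 m0; apply: sum_unique_le1.
suff H p q : hits x0 s u v p && ~~ hits x0 s u v p.-1 -> hits x0 s u v q &&
  ~~ hits x0 s u v q.-1 -> (p < q)%N -> False.
  move=> p q bp bq; case: (ltngtP p q) => // pq.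
    by case: (H _ _ bp bq pq).
  by case: (H _ _ bq bp pq).
move=> /andP[/andP[_ mp] _] /andP[/andP[mq _] /negP nm] pq; apply: nm.
have q0 : q.-1.+1 = q by rewrite prednK// (leq_ltn_trans _ pq).
apply/andP; split; first by apply: le_trans mq; apply: gridpt_le => //; exact: leq_pred.
by rewrite q0; apply: le_trans mp _; exact: gridpt_le.
Qed.

Lemma hits_last x0 s u v N : 0 < s ->
  \sum_(0 <= q < N) ((hits x0 s u v q && ~~ hits x0 s u v q.+1)%:R : R) <= 1.
Proof.
move=> s0; apply: sum_unique_le1.
suff H p q : hits x0 s u v p && ~~ hits x0 s u v p.+1 -> hits x0 s u v q &&
  ~~ hits x0 s u v q.+1 -> (p < q)%N -> False.
  move=> p q bp bq; case: (ltngtP p q) => // pq.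
    by case: (H _ _ bp bq pq).
  by case: (H _ _ bq bp pq).
move=> /andP[/andP[_ mp] /negP nm] /andP[/andP[mq _] _] pq; apply: nm.
apply/andP; split; first by apply: le_trans mq; exact: gridpt_le.
by apply: le_trans mp _; exact: gridpt_le.
Qed.
End GridSums.

(** * Contour integral of a large square estimated through small squares *)

Section GridEstimate.
Context {R : realType}.
Implicit Types (N p q : nat) (x y s t : R) (h F : R[i] -> R[i]).
Implicit Types (S : seq (R[i] * (R * R))) (j : R[i] * (R * R)).

Definition in_closed (a : R[i]) (r x y : R) :=
  (`|x - Re a| <= r) /\ (`|y - Im a| <= r).

(* An entry (a, (r, kappa)) of S is the square of centre a and half-side r; kappa
   bounds the error per unit length on the grid edges near that square. *)
Definition avoids S x y := forall j, j \in S -> ~ in_closed j.1 j.2.1 x y.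

Lemma hor_chasles h y x0 s N : 0 < s ->
  icont (fun t => h (t +i* y)) x0 (gridpt x0 s N) ->
  \sum_(0 <= p < N) hor h y (gridpt x0 s p) (gridpt x0 s p.+1) =
  hor h y x0 (gridpt x0 s N).
Proof.
move=> s0; elim: N => [_|N IH hc].
  rewrite big_geq// /gridpt mul0r addr0 /hor.
  by rewrite cint_point.
have xN : x0 <= gridpt x0 s N by rewrite /gridpt lerDl mulr_ge0// ltW.
have NN : gridpt x0 s N <= gridpt x0 s N.+1 by exact: gridpt_le.
rewrite big_nat_recr//= IH; last exact: icont_sub hc.
by rewrite /hor -(cint_chasles xN NN hc).
Qed.

Lemma ver_chasles h x y0 s N : 0 < s ->
  icont (fun t => h (x +i* t)) y0 (gridpt y0 s N) ->
  \sum_(0 <= p < N) ver h x (gridpt y0 s p) (gridpt y0 s p.+1) =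
  ver h x y0 (gridpt y0 s N).
Proof.
move=> s0; elim: N => [_|N IH hc].
  rewrite big_geq// /gridpt mul0r addr0 /ver.
  by rewrite cint_point mulr0.
have xN : y0 <= gridpt y0 s N by rewrite /gridpt lerDl mulr_ge0// ltW.
have NN : gridpt y0 s N <= gridpt y0 s N.+1 by exact: gridpt_le.
rewrite big_nat_recr//= IH; last exact: icont_sub hc.
by rewrite /ver -mulrDr -(cint_chasles xN NN hc).
Qed.

Lemma common_lower_bound (sigma : R) S : 0 < sigma ->
  (forall j, j \in S -> 0 < j.2.1) ->
  exists m : R, [/\ 0 < m, m <= sigma & forall j, j \in S -> m <= j.2.1].
Proof.
move=> sg0; elim: S => [_|j S IH HS]; first by exists sigma.
have [m [m0 ms mS]] : exists m : R,
    [/\ 0 < m, m <= sigma & forall j, j \in S -> m <= j.2.1].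
  by apply: IH => k kS; apply: HS; rewrite inE kS orbT.
exists (Num.min m j.2.1); split.
- by rewrite lt_min m0 HS// mem_head.
- by rewrite ge_min ms.
- move=> k; rewrite inE => /predU1P[->|/mS mk]; first by rewrite ge_min lexx orbT.
  by rewrite ge_min mk.
Qed.

Lemma ler_sum_mem (I : eqType) (s : seq I) (f : I -> R) i :
  (forall k, k \in s -> 0 <= f k) -> i \in s -> f i <= \sum_(k <- s) f k.
Proof.
move=> f0 si; rewrite (big_rem i)//= lerDl big_seq sumr_ge0// => k /mem_rem.
exact: f0.
Qed.

(** F stands for the product of u and the local primitive; being one function on the plane, its
    differences cancel around every cell. A boundary edge of U is also a boundary edge of the block
    of cells met by some single square. Such a block has at most one edge per row or column on each
    of its 4 sides, of total length at most [4 * r] per side when the mesh is at most r; whence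
    16. *)
Lemma grid_estimate h F x0 y0 (l sigma : R) S : 0 < l -> 0 < sigma ->
  (forall j, j \in S -> [/\ 0 < j.2.1, 0 <= j.2.2,
     x0 < Re j.1 - 2 * j.2.1 /\ Re j.1 + 2 * j.2.1 < x0 + l &
     y0 < Im j.1 - 2 * j.2.1 /\ Im j.1 + 2 * j.2.1 < y0 + l]) ->
  (forall x y, x0 <= x <= x0 + l -> y0 <= y <= y0 + l -> avoids S x y ->
     cdiffable h (x +i* y)) ->
  (forall j, j \in S -> forall x x' y, x <= x' -> x' - x <= sigma ->
     in_closed j.1 (2 * j.2.1) x y -> in_closed j.1 (2 * j.2.1) x' y ->
     (forall t, x <= t <= x' -> avoids S t y) ->
     normc (hor h y x x' - (F (x' +i* y) - F (x +i* y))) <= j.2.2 * (x' - x)) ->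
  (forall j, j \in S -> forall x y y', y <= y' -> y' - y <= sigma ->
     in_closed j.1 (2 * j.2.1) x y -> in_closed j.1 (2 * j.2.1) x y' ->
     (forall t, y <= t <= y' -> avoids S x t) ->
     normc (ver h x y y' - (F (x +i* y') - F (x +i* y))) <= j.2.2 * (y' - y)) ->
  normc (rect h x0 (x0 + l) y0 (y0 + l)) <= \sum_(j <- S) 16 * j.2.2 * j.2.1.
Proof.
move=> l0 sg0 HS hd Hh Hv.
have [m [m0 ms mS]] : exists m : R,
    [/\ 0 < m, m <= sigma & forall j, j \in S -> m <= j.2.1].
  by apply: common_lower_bound => // j /HS[].
(* The mesh [l / N] is at most m, hence at most sigma and every half-side. *)
pose N := (Num.bound (l / m)).+1.
have N0 : 0 < N%:R :> R by rewrite ltr0n.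
pose s := l / N%:R.
have s0 : 0 < s by rewrite divr_gt0.
have sm : s <= m.
  rewrite ler_pdivrMr// mulrC -ler_pdivrMr//; apply: ltW.
  apply: lt_trans (archi_boundP _) _; first by rewrite divr_ge0// ltW.
  by rewrite ltr_nat.
have sS j : j \in S -> s <= j.2.1 by move=> /mS; exact: le_trans.
pose X := gridpt x0 s; pose Y := gridpt y0 s.
have XN : X N = x0 + l by rewrite /X /gridpt /s mulrC divfK// gt_eqF.
have YN : Y N = y0 + l by rewrite /Y /gridpt /s mulrC divfK// gt_eqF.
have X0 : X 0%N = x0 by rewrite /X /gridpt mul0r addr0.
have Y0 : Y 0%N = y0 by rewrite /Y /gridpt mul0r addr0.
have XS p : X p.+1 = X p + s by exact: gridptS.
have YS p : Y p.+1 = Y p + s by exact: gridptS.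
have dX p : X p.+1 - X p = s by rewrite XS addrC addKr.
have dY p : Y p.+1 - Y p = s by rewrite YS addrC addKr.
have Xm p q : (p <= q)%N -> X p <= X q by exact: gridpt_le.
have Ym p q : (p <= q)%N -> Y p <= Y q by exact: gridpt_le.
pose P j p := hits x0 s (Re j.1 - j.2.1) (Re j.1 + j.2.1) p.
pose Q j q := hits y0 s (Im j.1 - j.2.1) (Im j.1 + j.2.1) q.
have PE j p : P j p = (X p <= Re j.1 + j.2.1) && (Re j.1 - j.2.1 <= X p.+1) by [].
have QE j p : Q j p = (Y p <= Im j.1 + j.2.1) && (Im j.1 - j.2.1 <= Y p.+1) by [].
pose U p q := has (fun j => P j p && Q j q) S.
have P0 j : j \in S -> P j 0%N = false.
  move=> jS; have [r0 _ [H _] _] := HS _ jS; have := sS _ jS => sj.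
  by apply/negP; rewrite PE XS X0 => /andP[_]; lra.
have Q0 j : j \in S -> Q j 0%N = false.
  move=> jS; have [r0 _ _ [H _]] := HS _ jS; have := sS _ jS => sj.
  by apply/negP; rewrite QE YS Y0 => /andP[_]; lra.
have PN j : j \in S -> P j N = false.
  move=> jS; have [r0 _ [_ H] _] := HS _ jS.
  by apply/negP; rewrite PE XN => /andP[+ _]; lra.
have QN j : j \in S -> Q j N = false.
  move=> jS; have [r0 _ _ [_ H]] := HS _ jS.
  by apply/negP; rewrite QE YN => /andP[+ _]; lra.
have hb x y : x0 <= x <= x0 + l -> y0 <= y <= y0 + l ->
    (x = x0 \/ x = x0 + l \/ y = y0 \/ y = y0 + l) -> cdiffable h (x +i* y).
  move=> xl yl xy; apply: hd => // j jS [].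
  have [r0 _ [H1 H2] [H3 H4]] := HS _ jS; rewrite !ler_norml.
  by move=> /andP[? ?] /andP[? ?]; case: xy => [|[|[|]]] ?; lra.
have lx : x0 <= x0 <= x0 + l by rewrite lexx lerDl ltW.
have ly : y0 <= y0 <= y0 + l by rewrite lexx lerDl ltW.
have rx : x0 <= x0 + l <= x0 + l by rewrite lexx lerDl ltW.
have ry : y0 <= y0 + l <= y0 + l by rewrite lexx lerDl ltW.
have -> : rect h x0 (x0 + l) y0 (y0 + l) =
  \sum_(0 <= p < N) hor h (Y 0%N) (X p) (X p.+1)
  + \sum_(0 <= q < N) ver h (X N) (Y q) (Y q.+1)
  - \sum_(0 <= p < N) hor h (Y N) (X p) (X p.+1)
  - \sum_(0 <= q < N) ver h (X 0%N) (Y q) (Y q.+1).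
  rewrite /X /Y !hor_chasles// ?ver_chasles//; rewrite -/X -/Y ?X0 ?Y0 ?XN ?YN //.
  - by move=> t tl; apply: ccont_ver; apply: cdiff_cont; apply: hb => //; tauto.
  - by move=> t tl; apply: ccont_ver; apply: cdiff_cont; apply: hb => //; tauto.
  - by move=> t tl; apply: ccont_hor; apply: cdiff_cont; apply: hb => //; tauto.
  - by move=> t tl; apply: ccont_hor; apply: cdiff_cont; apply: hb => //; tauto.
(* An edge is charged to all squares selected by b, not just to one; overcounting keeps the later
   sum separable in the squares. *)
pose wgt (b : R[i] * (R * R) -> bool) := \sum_(j <- S) j.2.2 * s * (b j)%:R.
have wgt0 b : 0 <= wgt b.
  rewrite /wgt big_seq sumr_ge0// => j jS; have [_ k0 _ _] := HS _ jS.
  by rewrite !mulr_ge0// ltW.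
have wgt_ge (b : R[i] * (R * R) -> bool) j : j \in S -> b j -> j.2.2 * s <= wgt b.
  move=> jS bj; have -> : j.2.2 * s = j.2.2 * s * (b j)%:R by rewrite bj mulr1.
  apply: (@ler_sum_mem _ S (fun j => j.2.2 * s * (b j)%:R)) => // k kS.
  by have [_ k0 _ _] := HS _ kS; rewrite !mulr_ge0// ltW.
(* A cell of size at most r that meets the square stays in the square doubled about its centre,
   where F is controlled. *)
have Pin j p : j \in S -> P j p ->
    `|X p - Re j.1| <= 2 * j.2.1 /\ `|X p.+1 - Re j.1| <= 2 * j.2.1.
  move=> jS; rewrite PE XS => /andP[? ?]; have := sS _ jS => ?.
  by rewrite !ler_norml; split; apply/andP; split; lra.
have Qin j p : j \in S -> Q j p ->
    `|Y p - Im j.1| <= 2 * j.2.1 /\ `|Y p.+1 - Im j.1| <= 2 * j.2.1.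
  move=> jS; rewrite QE YS => /andP[? ?]; have := sS _ jS => ?.
  by rewrite !ler_norml; split; apply/andP; split; lra.
have Pt j p t : X p <= t <= X p.+1 -> `|t - Re j.1| <= j.2.1 -> P j p.
  rewrite PE ler_norml => /andP[? ?] /andP[? ?]; apply/andP; split; lra.
have Qt j p t : Y p <= t <= Y p.+1 -> `|t - Im j.1| <= j.2.1 -> Q j p.
  rewrite QE ler_norml => /andP[? ?] /andP[? ?]; apply/andP; split; lra.
have Ufree p q x y : ~~ U p q -> X p <= x <= X p.+1 -> Y q <= y <= Y q.+1 ->
    avoids S x y.
  move=> /hasPn nU xp yq j jS [xj yj].
  by have := nU _ jS; rewrite (Pt _ _ _ xp xj) (Qt _ _ _ yq yj).
have Upos p q : U p q -> (0 < p)%N /\ (0 < q)%N.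
  move=> /hasP[j jS /andP[Pj Qj]]; split.
    by case: p Pj => //; rewrite P0.
  by case: q Qj => //; rewrite Q0.
have Xi p : X p <= X p <= X p.+1 by rewrite lexx Xm.
have Xi' p : X p <= X p.+1 <= X p.+1 by rewrite lexx Xm.
have Yi p : Y p <= Y p <= Y p.+1 by rewrite lexx Ym.
have Yi' p : Y p <= Y p.+1 <= Y p.+1 by rewrite lexx Ym.
(* [b1] to [b4] select the squares whose own block has the lower, upper, left or right edge of the
   cell on its boundary. *)
pose b1 p q j := (P j p && Q j q) && ~~ (P j p && Q j q.-1).
pose b2 p q j := (P j p && Q j q) && ~~ (P j p && Q j q.+1).
pose b3 p q j := (P j p && Q j q) && ~~ (P j p.-1 && Q j q).
pose b4 p q j := (P j p && Q j q) && ~~ (P j p.+1 && Q j q).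
have ssg : s <= sigma by exact: le_trans ms.
apply: le_trans (@grid_boundary _ N (fun p q => hor h (Y q) (X p) (X p.+1))
  (fun p q => ver h (X p) (Y q) (Y q.+1))
  (fun p q => F (X p.+1 +i* Y q) - F (X p +i* Y q))
  (fun p q => F (X p +i* Y q.+1) - F (X p +i* Y q)) U
  (fun p q => wgt (b1 p q)) (fun p q => wgt (b2 p q))
  (fun p q => wgt (b3 p q)) (fun p q => wgt (b4 p q))
  _ _ _ _ _ _ _ _ _ _ _ _ _ _) _ => //.
- move=> p q pN qN Upq nU; have [p0 q0] := Upos _ _ Upq;
  have q1 : q.-1.+1 = q by rewrite prednK.
  have [j jS /andP[Pj Qj]] := hasP Upq; have nj := hasPn nU j jS.
  have [x1 x2] := Pin _ _ jS Pj; have [y1 y2] := Qin _ _ jS Qj.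
  apply: (@le_trans _ _ (j.2.2 * s)); last by apply: wgt_ge => //; apply/andP; split;
    [rewrite Pj Qj|exact: nj].
  rewrite -(dX p); apply: (Hh j jS (X p) (X p.+1) (Y q) (Xm _ _ (leqnSn _)) _ (conj x1
    y1) (conj x2 y1)).
    by rewrite dX.
  (* The edge also belongs to the closed cell below, which is off U, so it avoids all squares. *)
  by move=> t tp; apply: (Ufree p q.-1) => //; rewrite q1 lexx Ym ?leq_pred.
- move=> p q pN qN Upq nU.
  have [j jS /andP[Pj Qj]] := hasP Upq; have nj := hasPn nU j jS.
  have [x1 x2] := Pin _ _ jS Pj; have [y1 y2] := Qin _ _ jS Qj.
  apply: (@le_trans _ _ (j.2.2 * s)); last by apply: wgt_ge => //; apply/andP; split;
    [rewrite Pj Qj|exact: nj].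
  rewrite -(dX p); apply: (Hh j jS (X p) (X p.+1) (Y q.+1) (Xm _ _ (leqnSn _)) _ (conj
    x1 y2) (conj x2 y2)).
    by rewrite dX.
  by move=> t tp; apply: (Ufree p q.+1) => //.
- move=> p q pN qN Upq nU; have [p0 q0] := Upos _ _ Upq;
  have p1 : p.-1.+1 = p by rewrite prednK.
  have [j jS /andP[Pj Qj]] := hasP Upq; have nj := hasPn nU j jS.
  have [x1 x2] := Pin _ _ jS Pj; have [y1 y2] := Qin _ _ jS Qj.
  apply: (@le_trans _ _ (j.2.2 * s)); last by apply: wgt_ge => //; apply/andP; split;
    [rewrite Pj Qj|exact: nj].
  rewrite -(dY q); apply: (Hv j jS (X p) (Y q) (Y q.+1) (Ym _ _ (leqnSn _)) _ (conj x1
    y1) (conj x1 y2)).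
    by rewrite dY.
  by move=> t tp; apply: (Ufree p.-1 q) => //; rewrite p1 lexx Xm ?leq_pred.
- move=> p q pN qN Upq nU.
  have [j jS /andP[Pj Qj]] := hasP Upq; have nj := hasPn nU j jS.
  have [x1 x2] := Pin _ _ jS Pj; have [y1 y2] := Qin _ _ jS Qj.
  apply: (@le_trans _ _ (j.2.2 * s)); last by apply: wgt_ge => //; apply/andP; split;
    [rewrite Pj Qj|exact: nj].
  rewrite -(dY q); apply: (Hv j jS (X p.+1) (Y q) (Y q.+1) (Ym _ _ (leqnSn _)) _ (conj
    x2 y1) (conj x2 y2)).
    by rewrite dY.
  by move=> t tp; apply: (Ufree p.+1 q) => //.
- by move=> p q; ring.
- move=> p q pN qN nU.
  have -> : hor h (Y q) (X p) (X p.+1) + ver h (X p.+1) (Y q) (Y q.+1) -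
    hor h (Y q.+1) (X p) (X p.+1) - ver h (X p) (Y q) (Y q.+1) =
    rect h (X p) (X p.+1) (Y q) (Y q.+1) by [].
  apply: goursat; rewrite ?Xm ?Ym// => x y xp yq.
  apply: hd; last exact: Ufree nU xp yq.
    case/andP: xp => xp px; rewrite -XN -{1}X0 (le_trans _ xp) ?Xm//.
    by rewrite (le_trans px) ?Xm.
  case/andP: yq => yq qy; rewrite -YN -{1}Y0 (le_trans _ yq) ?Ym//.
  by rewrite (le_trans qy) ?Ym.
- by move=> p; apply/hasPn => j jS; rewrite Q0// andbF.
- by move=> p; apply/hasPn => j jS; rewrite QN// andbF.
- by move=> p; apply/hasPn => j jS; rewrite P0.
- by move=> p; apply/hasPn => j jS; rewrite PN.
(* Along one axis c counts the cells met, of total length at most [4 * r]; along the other, d marks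
   the single end of the run. The two alternatives exchange the axes. *)
have count (b : nat -> nat -> R[i] * (R * R) -> bool) :
   (forall j, j \in S -> exists c d : nat -> bool,
      [/\ forall p q, b p q j = c p && d q,
         \sum_(0 <= p < N) (c p)%:R * s <= 4 * j.2.1 &
         \sum_(0 <= q < N) ((d q)%:R : R) <= 1] \/
      [/\ forall p q, b p q j = d p && c q,
         \sum_(0 <= p < N) (c p)%:R * s <= 4 * j.2.1 &
         \sum_(0 <= q < N) ((d q)%:R : R) <= 1]) ->
   \sum_(0 <= p < N) \sum_(0 <= q < N) wgt (b p q) <=
     \sum_(j <- S) 4 * j.2.2 * j.2.1.
  move=> Hb; rewrite /wgt.
  under eq_bigr do rewrite exchange_big /=.
  rewrite exchange_big /= big_seq [leRHS]big_seq; apply: ler_sum => j jS.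
  have [r0 k0 _ _] := HS _ jS.
  have bnd (c d : nat -> bool) : \sum_(0 <= p < N) (c p)%:R * s <= 4 * j.2.1 ->
      \sum_(0 <= q < N) ((d q)%:R : R) <= 1 ->
      \sum_(0 <= p < N) \sum_(0 <= q < N) j.2.2 * s * (c p && d q)%:R
        <= 4 * j.2.2 * j.2.1.
    move=> Hc Hd.
    have -> : \sum_(0 <= p < N) \sum_(0 <= q < N) j.2.2 * s * (c p && d q)%:R =
        j.2.2 * ((\sum_(0 <= p < N) (c p)%:R * s) * \sum_(0 <= q < N) (d q)%:R).
      rewrite big_distrlr /= mulr_sumr; apply: eq_bigr => p _.
      rewrite mulr_sumr; apply: eq_bigr => q _; rewrite -mulnb natrM; ring.
    have -> : 4 * j.2.2 * j.2.1 = j.2.2 * (4 * j.2.1 * 1) by ring.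
    apply: ler_wpM2l => //; apply: ler_pM => //.
      by apply: sumr_ge0 => p _; rewrite mulr_ge0// ltW.
    by apply: sumr_ge0.
  have [c [d [] [bE Hc Hd]]] := Hb _ jS.
    under eq_bigr do under eq_bigr do rewrite bE.
    exact: bnd.
  under eq_bigr do under eq_bigr do rewrite bE.
  rewrite exchange_big /=.
  under eq_bigr do under eq_bigr do rewrite andbC.
  exact: bnd.
have cP j : j \in S -> \sum_(0 <= p < N) (P j p)%:R * s <= 4 * j.2.1.
  move=> jS; have [r0 _ _ _] := HS _ jS; have := sS _ jS => sj.
  apply: le_trans (hits_count _ _ s0 _) _; lra.
have cQ j : j \in S -> \sum_(0 <= p < N) (Q j p)%:R * s <= 4 * j.2.1.
  move=> jS; have [r0 _ _ _] := HS _ jS; have := sS _ jS => sj.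
  apply: le_trans (hits_count _ _ s0 _) _; lra.
have C1 : \sum_(0 <= p < N) \sum_(0 <= q < N) wgt (b1 p q) <=
    \sum_(j <- S) 4 * j.2.2 * j.2.1.
  apply: count => j jS; exists (P j), (fun q => Q j q && ~~ Q j q.-1); left; split.
  - by move=> p q; rewrite /b1; case: (P j p).
  - exact: cP.
  - by apply: hits_first => //; rewrite -/(Q j 0%N) Q0.
have C2 : \sum_(0 <= p < N) \sum_(0 <= q < N) wgt (b2 p q) <=
    \sum_(j <- S) 4 * j.2.2 * j.2.1.
  apply: count => j jS; exists (P j), (fun q => Q j q && ~~ Q j q.+1); left; split.
  - by move=> p q; rewrite /b2; case: (P j p).
  - exact: cP.
  - exact: hits_last.
have C3 : \sum_(0 <= p < N) \sum_(0 <= q < N) wgt (b3 p q) <=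
    \sum_(j <- S) 4 * j.2.2 * j.2.1.
  apply: count => j jS; exists (Q j), (fun q => P j q && ~~ P j q.-1); right; split.
  - by move=> p q; rewrite /b3; case: (Q j q); rewrite ?andbT ?andbF.
  - exact: cQ.
  - by apply: hits_first => //; rewrite -/(P j 0%N) P0.
have C4 : \sum_(0 <= p < N) \sum_(0 <= q < N) wgt (b4 p q) <=
    \sum_(j <- S) 4 * j.2.2 * j.2.1.
  apply: count => j jS; exists (Q j), (fun q => P j q && ~~ P j q.+1); right; split.
  - by move=> p q; rewrite /b4; case: (Q j q); rewrite ?andbT ?andbF.
  - exact: cQ.
  - exact: hits_last.
have -> : \sum_(j <- S) 16 * j.2.2 * j.2.1 = 4 * \sum_(j <- S) 4 * j.2.2 * j.2.1.
  by rewrite mulr_sumr; apply: eq_bigr => j _; ring.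
under eq_bigr do rewrite !big_split /=.
rewrite !big_split /=; lra.
Qed.
End GridEstimate.

(** * Integration by parts along an edge *)

Section Cauchy.
Context {R : realType}.
Implicit Types (f h : R[i] -> R[i]) (u v : R -> R[i]) (x y t a b : R) (w z p : R[i]).

Lemma cdiffableP f z : cdiffable f z <-> derivable f z 1.
Proof.
by split=> [[D /cdiff_derivable]//|fz]; exists (derive1 f z); exact: derivable_cdiff.
Qed.

Lemma cdiffableM f h z : cdiffable f z -> cdiffable h z ->
  cdiffable (fun w => f w * h w) z.
Proof. by rewrite !cdiffableP => fz hz; exact: (derivableM fz hz). Qed.

Lemma cdiffableV f z : f z != 0 -> cdiffable f z ->
  cdiffable (fun w => (f w)^-1) z.
Proof. by rewrite !cdiffableP => fz0 fz; exact: (derivableV fz0 fz). Qed.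

Lemma cdiffable_subc f c z : cdiffable f z -> cdiffable (fun w => f w - c) z.
Proof.
move=> [D hD]; exists D => e /hD[r r0 H]; exists r => // w /H.
by rewrite opprB addrA subrK.
Qed.

Lemma cdiffable_id z : cdiffable id z.
Proof.
exists 1 => e e0; exists 1 => // w _.
by rewrite mul1r subrr normc0 mulr_ge0 ?normc_ge0// ltW.
Qed.

Lemma cdiffable_kernel z w : w != z -> cdiffable (fun p => (p - z)^-1) w.
Proof.
move=> wz; apply: cdiffableV; first by rewrite subr_eq0.
by apply: cdiffable_subc; exact: cdiffable_id.
Qed.

Lemma cdiff_near f h z D (r : R) : 0 < r ->
  (forall w, normc (w - z) < r -> f w = h w) -> cdiff f z D -> cdiff h z D.
Proof.
move=> r0 fh fD e /fD[s s0 H]; exists (Num.min r s); first by rewrite lt_min r0.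
move=> w; rewrite lt_min => /andP[/fh wz /H]; rewrite wz fh//.
by rewrite subrr normc0.
Qed.

(** Mean value inequality for complex values: the bound [(M + e)] times the length is additive under
    halving, and near p it follows by adding the increments on both sides of p. *)
Lemma lipschitz_segment u a b (M : R) : a <= b ->
  (forall t, a <= t <= b -> forall e, 0 < e -> exists2 r : R, 0 < r &
     forall t', `|t' - t| < r -> normc (u t' - u t) <= (M + e) * `|t' - t|) ->
  normc (u b - u a) <= M * (b - a).
Proof.
move=> ab H; have l0 : 0 <= b - a by rewrite subr_ge0.
have abE : a + (b - a) = b by rewrite addrC subrK.
suff He e : 0 < e -> normc (u b - u a) <= (M + e) * (b - a).
  apply/ler_addgt0Pl => e e0.
  have C1 : 0 < (b - a) + 1 by rewrite ltr_wpDl.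
  apply: le_trans (He _ (divr_gt0 e0 C1)) _.
  rewrite mulrDl addrC lerD2r mulrAC ler_pdivrMr// ler_pM2l// lerDl//.
move=> e0; pose ln n := (b - a) / 2 ^+ n : R.
pose P x (y : R) n := normc (u (x + ln n) - u x) <= (M + e) * ln n.
have lnS n : ln n = ln n.+1 + ln n.+1.
  by rewrite /ln exprS invfM; field; rewrite expf_neq0// pnatr_eq0.
suff : P a 0 0%N by rewrite /P /ln expr0 divr1 abE.
apply: (@bisection _ P a 0 (b - a) 0) => //.
  move=> x y n; rewrite -/(ln _) mul0r addr0 /P => P1 P2 _ _.
  rewrite (lnS n) addrA mulrDr.
  have := normc_triangle (u (x + ln n.+1 + ln n.+1)) (u (x + ln n.+1)) (u x).
  lra.
move=> p q; rewrite abE => pab _; have [r r0 Hr] := H p pab e e0.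
exists r => // x y n; rewrite -/(ln _) => /andP[xp px] _ lr _; rewrite /P.
have H1 := Hr (x + ln n); have H2 := Hr x.
have E1 : `|x + ln n - p| = x + ln n - p by rewrite ger0_norm// subr_ge0.
have E2 : `|x - p| = p - x by rewrite ler0_norm ?opprB// subr_le0.
rewrite E1 in H1; rewrite E2 in H2.
have H1' : normc (u (x + ln n) - u p) <= (M + e) * (x + ln n - p).
  by apply: H1; lra.
have H2' : normc (u x - u p) <= (M + e) * (p - x) by apply: H2; lra.
rewrite normcB in H2'.
have := normc_triangle (u (x + ln n)) (u p) (u x).
have -> : (M + e) * ln n = (M + e) * (x + ln n - p) + (M + e) * (p - x) by ring.
lra.
Qed.

Lemma cdiff_lipschitz f z D (M : R) : cdiff f z D -> normc D <= M ->
  forall e, 0 < e -> exists2 r : R, 0 < r &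
    forall w, normc (w - z) < r -> normc (f w - f z) <= (M + e) * normc (w - z).
Proof.
move=> fD DM e e0; have [r r0 H] := fD _ e0; exists r => // w /H Hw.
apply: le_trans (normc_le_sum _ (D * (w - z))) _; rewrite normcM mulrDl addrC.
by apply: lerD => //; rewrite ler_wpM2r// normc_ge0.
Qed.

Lemma hor_sub t t' y : normc (t' +i* y - (t +i* y)) = `|t' - t| :> R.
Proof.
rewrite -[_ - _]/((t' - t) +i* (y - y)) subrr.
by rewrite -[_ +i* _]/((t' - t)%:C) normc_real.
Qed.

Lemma ver_sub x t t' : normc (x +i* t' - (x +i* t)) = `|t' - t| :> R.
Proof.
rewrite -[_ - _]/((x - x) +i* (t' - t)) subrr.
by rewrite /normc /= expr0n add0r sqrtr_sqr.
Qed.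

Lemma lipschitz_hor f (M : R) y a b : a <= b ->
  (forall t, a <= t <= b -> exists2 D, cdiff f (t +i* y) D & normc D <= M) ->
  normc (f (b +i* y) - f (a +i* y)) <= M * (b - a).
Proof.
move=> ab H; apply: (@lipschitz_segment (fun t => f (t +i* y))) => // t /H[D fD DM] e e0.
have [r r0 Hr] := cdiff_lipschitz fD DM e0; exists r => // t' tt.
by rewrite -(hor_sub t t' y); apply: Hr; rewrite hor_sub.
Qed.

Lemma lipschitz_ver f (M : R) x a b : a <= b ->
  (forall t, a <= t <= b -> exists2 D, cdiff f (x +i* t) D & normc D <= M) ->
  normc (f (x +i* b) - f (x +i* a)) <= M * (b - a).
Proof.
move=> ab H; apply: (@lipschitz_segment (fun t => f (x +i* t))) => // t /H[D fD DM] e e0.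
have [r r0 Hr] := cdiff_lipschitz fD DM e0; exists r => // t' tt.
by rewrite -(ver_sub x t t'); apply: Hr; rewrite ver_sub.
Qed.

Lemma ccontM u v t : ccont u t -> ccont v t -> ccont (fun x => u x * v x) t.
Proof.
move=> uc vc e e0.
have A0 : 0 < normc (u t) + 1 by rewrite ltr_wpDl// normc_ge0.
have B0 : 0 < normc (v t) + 1 by rewrite ltr_wpDl// normc_ge0.
have e20 : 0 < e / 2 by rewrite divr_gt0.
have [r r0 Hr] := uc _ (divr_gt0 e20 B0).
have m0 : 0 < Num.min 1 (e / 2 / (normc (u t) + 1)) by rewrite lt_min ltr01 divr_gt0.
have [s s0 Hs] := vc _ m0.
exists (Num.min r s); first by rewrite lt_min r0 s0.
move=> x; rewrite lt_min => /andP[/Hr ux /Hs]; rewrite le_min => /andP[v1 vx].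
have -> : u x * v x - u t * v t = (u x - u t) * v x + u t * (v x - v t) by ring.
apply: le_trans (normcD_le _ _) _; rewrite !normcM (splitr e).
apply: lerD.
  have vB : normc (v x) <= normc (v t) + 1.
    by apply: le_trans (normc_le_sum _ (v t)) _; rewrite addrC lerD2l.
  apply: le_trans (ler_pM (normc_ge0 _) (normc_ge0 _) ux vB) _.
  by rewrite divfK// gt_eqF.
have uB : normc (u t) <= normc (u t) + 1 by rewrite lerDl.
apply: le_trans (ler_pM (normc_ge0 _) (normc_ge0 _) uB vx) _.
by rewrite mulrC divfK// gt_eqF.
Qed.

(* Integration by parts along an edge: the bound involves only the variation of u,
   not its size. *)
Lemma edge_by_parts u v a b (c psi0 psi1 : R[i]) (M B Psi : R) : a <= b ->
  icont u a b -> icont v a b -> 0 <= M ->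
  c * cint v a b = psi1 - psi0 -> normc c = 1 ->
  (forall t, a <= t <= b -> normc (u t - u a) <= M * (t - a)) ->
  (forall t, a <= t <= b -> normc (v t) <= B) -> normc psi1 <= Psi ->
  normc (c * cint (fun t => u t * v t) a b - (u b * psi1 - u a * psi0)) <=
    M * (b - a) * (2 * B * (b - a) + Psi).
Proof.
move=> ab uc vc M0 psiE c1 uM vB psiB.
have uvc : icont (fun t => u t * v t) a b.
  by move=> t tab; apply: ccontM; [exact: uc|exact: vc].
have uac : icont (fun t => - u a * v t) a b.
  by move=> t tab; apply: ccontZ; exact: vc.
(* Subtracting the constant [u a] leaves a factor of size [M * (b - a)]; the constant part is
   integrated exactly by psi. Thus no integral of the derivative of u occurs. *)
pose g t := u t * v t + (- u a) * v t.
have gE : cint g a b = cint (fun t => u t * v t) a b - u a * cint v a b.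
  by rewrite /g cintD// cintZ// mulNr.
have -> : c * cint (fun t => u t * v t) a b - (u b * psi1 - u a * psi0) =
    c * cint g a b - (u b - u a) * psi1.
  rewrite gE mulrBr (mulrCA c) psiE; ring.
apply: le_trans (normcD_le _ _) _; rewrite normcN !normcM c1 mul1r.
have ba0 : 0 <= b - a by rewrite subr_ge0.
have H1 : normc (cint g a b) <= 2 * (M * (b - a) * B * (b - a)).
  apply: cint_bound => //.
    by move=> t tab; apply: ccontD; [exact: uvc|exact: uac].
  move=> t tab; rewrite /g -mulrDl normcM; apply: ler_pM; rewrite ?normc_ge0//.
    apply: le_trans (uM _ tab) _; apply: ler_wpM2l => //.
    by case/andP: tab => _; rewrite lerD2r.
  exact: vB.
have H2 : normc (u b - u a) * normc psi1 <= M * (b - a) * Psi.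
  by apply: ler_pM; rewrite ?normc_ge0// uM// lexx ab.
have -> : M * (b - a) * (2 * B * (b - a) + Psi) =
  2 * (M * (b - a) * B * (b - a)) + M * (b - a) * Psi by ring.
exact: lerD.
Qed.
End Cauchy.

(** * Vanishing of the Cauchy-type integral *)

Section CauchyVanish.
Context {R : realType}.
Implicit Types (f h k : R[i] -> R[i]) (x y s t : R) (b v w z p : R[i]).

(** Integral of k from b to v along a path with one corner, horizontal leg before vertical.
    Increments along vertical edges are then immediate; along horizontal edges they come from
    [goursat] on the rectangle below the edge. *)
Definition primitive k b v :=
  hor k (Im b) (Re b) (Re v) + ver k (Re v) (Im b) (Im v).

Lemma primitive_hor k b x x' y : Re b <= x -> x <= x' -> Im b <= y ->
  (forall s t, Re b <= s <= x' -> Im b <= t <= y -> cdiffable k (s +i* t)) ->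
  hor k y x x' = primitive k b (x' +i* y) - primitive k b (x +i* y).
Proof.
move=> bx xx' yb kd; rewrite /primitive /=.
have R0 : rect k x x' (Im b) y = 0.
  apply: goursat => // s t /andP[xs sx] tb; apply: kd => //.
  by rewrite (le_trans bx xs).
have kc : icont (fun t => k (t +i* Im b)) (Re b) x'.
  by move=> t tb; apply/ccont_hor/cdiff_cont; apply: kd => //; rewrite lexx.
have C : hor k (Im b) (Re b) x' = hor k (Im b) (Re b) x + hor k (Im b) x x'.
  exact: cint_chasles kc.
by rewrite C -[LHS]addr0 -R0 /rect; ring.
Qed.

Lemma primitive_ver k b x y y' : Re b <= x -> Im b <= y -> y <= y' ->
  (forall s t, Re b <= s <= x -> Im b <= t <= y' -> cdiffable k (s +i* t)) ->
  ver k x y y' = primitive k b (x +i* y') - primitive k b (x +i* y).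
Proof.
move=> bx yb yy' kd; rewrite /primitive /=.
have kc : icont (fun t => k (x +i* t)) (Im b) y'.
  by move=> t tb; apply/ccont_ver/cdiff_cont; apply: kd => //; rewrite lexx bx.
have C : ver k x (Im b) y' = ver k x (Im b) y + ver k x y y'.
  by rewrite /ver -mulrDr -cint_chasles.
by rewrite C; ring.
Qed.

Lemma normc_i : normc 'i%C = 1 :> R.
Proof. by rewrite /normc /= expr0n expr1n add0r sqrtr1. Qed.

Lemma primitive_bound k b v (B e : R) : Re b <= Re v -> Im b <= Im v ->
  0 <= B -> Re v - Re b <= e -> Im v - Im b <= e ->
  (forall s t, Re b <= s <= Re v -> Im b <= t <= Im v ->
     cdiffable k (s +i* t) /\ normc (k (s +i* t)) <= B) ->
  normc (primitive k b v) <= 4 * (B * e).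
Proof.
move=> rv iv B0 re ie H.
have H1 : normc (hor k (Im b) (Re b) (Re v)) <= 2 * (B * (Re v - Re b)).
  apply: cint_bound => // t tb.
    by apply/ccont_hor/cdiff_cont; apply: (H _ _ _ _).1 => //; rewrite lexx.
  by apply: (H _ _ _ _).2 => //; rewrite lexx.
have H2 : normc (ver k (Re v) (Im b) (Im v)) <= 2 * (B * (Im v - Im b)).
  rewrite normcM normc_i mul1r; apply: cint_bound => // t tb.
    by apply/ccont_ver/cdiff_cont; apply: (H _ _ _ _).1 => //; rewrite lexx rv.
  by apply: (H _ _ _ _).2 => //; rewrite lexx rv.
apply: le_trans (normcD_le _ _) _.
have H3 : B * (Re v - Re b) <= B * e by exact: ler_wpM2l.
have H4 : B * (Im v - Im b) <= B * e by exact: ler_wpM2l.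
lra.
Qed.

Lemma in_closed_normc a (q : R) x y : in_closed a q x y -> normc (x +i* y - a) <= 2 * q.
Proof.
move=> [xa ya]; apply: le_trans (normc_le_ReIm _) _.
by rewrite !cReD !cImD !cReN !cImN /=; lra.
Qed.

Lemma in_closed_hor a (q : R) x t x' y : in_closed a q x y -> in_closed a q x' y ->
  x <= t <= x' -> in_closed a q t y.
Proof.
move=> [p1 ?] [p2 ?] /andP[? ?]; split=> //; move: p1 p2.
by rewrite !ler_norml => /andP[? ?] /andP[? ?]; apply/andP; split; lra.
Qed.

Lemma in_closed_ver a (q : R) x y t y' : in_closed a q x y -> in_closed a q x y' ->
  y <= t <= y' -> in_closed a q x t.
Proof.
move=> [? p1] [? p2] /andP[? ?]; split=> //; move: p1 p2.
by rewrite !ler_norml => /andP[? ?] /andP[? ?]; apply/andP; split; lra.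
Qed.

Lemma dist_in_closed (c q x x' : R) : `|x - c| <= q -> `|x' - c| <= q ->
  x' - x <= 2 * q.
Proof. by rewrite !ler_norml => /andP[? ?] /andP[? ?]; lra. Qed.

Lemma normc_coord w p (e : R) : normc (w - p) <= e ->
  Re p - e <= Re w <= Re p + e /\ Im p - e <= Im w <= Im p + e.
Proof.
move=> wp; have := Re_le_normc (w - p); have := Im_le_normc (w - p).
rewrite cReD cImD cReN cImN !ler_norml => /andP[? ?] /andP[? ?].
by split; apply/andP; split; lra.
Qed.

(** [primitive] needs its base to the lower left of its argument; the shift by [2 * eta] ensures
    this for all points within eta of w. *)
Definition corner (eta : R) w := (Re w - 2 * eta) +i* (Im w - 2 * eta).

Section EdgeEstimate.
Variables (u k : R[i] -> R[i]) (M B eta : R) (p : R[i]).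
Hypotheses (M0 : 0 <= M) (B0 : 0 <= B) (eta0 : 0 <= eta).
Hypothesis kbox : forall s t, Re p - 2 * eta <= s <= Re p + eta ->
  Im p - 2 * eta <= t <= Im p + eta ->
  cdiffable k (s +i* t) /\ normc (k (s +i* t)) <= B.

(** Both legs of the path have length at most [3 * eta], and 12 is 3 times the constant of
    [primitive_bound]. *)
Lemma primitive_corner_bound w : normc (w - p) <= eta ->
  normc (primitive k (corner eta p) w) <= 12 * B * eta.
Proof.
move=> /normc_coord[/andP[c1 c2] /andP[c3 c4]]; have e0 := eta0; have b0 := B0.
have -> : 12 * B * eta = 4 * (B * (3 * eta)) by ring.
apply: primitive_bound => //=; try lra.
move=> s t /andP[s1 s2] /andP[t1 t2].
by apply: kbox; apply/andP; split; lra.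
Qed.

(** Both terms of [edge_by_parts] gain the factor eta, one from the edge length and one from the
    primitive: 14 is 2 + 12. *)
Lemma edge_hor x x' y : x <= x' -> x' - x <= eta ->
  normc (x +i* y - p) <= eta -> normc (x' +i* y - p) <= eta ->
  (forall t, x <= t <= x' -> exists2 D, cdiff u (t +i* y) D & normc D <= M) ->
  normc (hor (fun w => u w * k w) y x x' -
    (u (x' +i* y) * primitive k (corner eta p) (x' +i* y) -
     u (x +i* y) * primitive k (corner eta p) (x +i* y))) <=
  14 * M * B * eta * (x' - x).
Proof.
move=> xx' xeta vp vp' ud.
have e0 := eta0; have [/andP[e1 e2] /andP[e3 e4]] := normc_coord vp.
have [/andP[e1' e2'] /andP[e3' e4']] := normc_coord vp'.
rewrite /= in e1 e2 e3 e4 e1' e2' e3' e4'.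
have kt t : x <= t <= x' -> cdiffable k (t +i* y) /\ normc (k (t +i* y)) <= B.
  by move=> /andP[? ?]; apply: kbox; apply/andP; split; lra.
rewrite -[hor _ _ _ _]mul1r.
apply: le_trans (@edge_by_parts _ (fun t => u (t +i* y)) (fun t => k (t +i* y)) x x' 1
  (primitive k (corner eta p) (x +i* y)) (primitive k (corner eta p) (x' +i* y))
  M B (12 * B * eta) xx' _ _ M0 _ _ _ _ _) _ => //.
- by move=> t /ud[D uD _]; apply/ccont_hor/cdiff_cont; exists D.
- by move=> t /kt[kd _]; exact/ccont_hor/cdiff_cont.
- rewrite mul1r; apply: primitive_hor => //=; try lra.
  move=> s t /andP[? ?] /andP[? ?].
  by apply: (kbox _ _).1; apply/andP; split; lra.
- exact: normc1.
- move=> t /andP[t1 t2]; apply: lipschitz_hor => // t' /andP[t1' t2']; apply: ud.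
  by rewrite t1' (le_trans t2' t2).
- by move=> t /kt[].
- exact: primitive_corner_bound.
- have -> : 14 * M * B * eta * (x' - x) =
    M * (x' - x) * (2 * B * eta + 12 * B * eta) by ring.
  apply: ler_wpM2l; first by rewrite mulr_ge0// subr_ge0.
  by rewrite lerD2r; apply: ler_wpM2l => //; rewrite mulr_ge0.
Qed.

Lemma edge_ver x y y' : y <= y' -> y' - y <= eta ->
  normc (x +i* y - p) <= eta -> normc (x +i* y' - p) <= eta ->
  (forall t, y <= t <= y' -> exists2 D, cdiff u (x +i* t) D & normc D <= M) ->
  normc (ver (fun w => u w * k w) x y y' -
    (u (x +i* y') * primitive k (corner eta p) (x +i* y') -
     u (x +i* y) * primitive k (corner eta p) (x +i* y))) <=
  14 * M * B * eta * (y' - y).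
Proof.
move=> yy' yeta vp vp' ud.
have e0 := eta0; have [/andP[e1 e2] /andP[e3 e4]] := normc_coord vp.
have [/andP[e1' e2'] /andP[e3' e4']] := normc_coord vp'.
rewrite /= in e1 e2 e3 e4 e1' e2' e3' e4'.
have kt t : y <= t <= y' -> cdiffable k (x +i* t) /\ normc (k (x +i* t)) <= B.
  by move=> /andP[? ?]; apply: kbox; apply/andP; split; lra.
apply: le_trans (@edge_by_parts _ (fun t => u (x +i* t)) (fun t => k (x +i* t)) y y' 'i%C
  (primitive k (corner eta p) (x +i* y)) (primitive k (corner eta p) (x +i* y'))
  M B (12 * B * eta) yy' _ _ M0 _ _ _ _ _) _ => //.
- by move=> t /ud[D uD _]; apply/ccont_ver/cdiff_cont; exists D.
- by move=> t /kt[kd _]; exact/ccont_ver/cdiff_cont.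
- apply: primitive_ver => //=; try lra.
  move=> s t /andP[? ?] /andP[? ?].
  by apply: (kbox _ _).1; apply/andP; split; lra.
- exact: normc_i.
- move=> t /andP[t1 t2]; apply: lipschitz_ver => // t' /andP[t1' t2']; apply: ud.
  by rewrite t1' (le_trans t2' t2).
- by move=> t /kt[].
- exact: primitive_corner_bound.
- have -> : 14 * M * B * eta * (y' - y) =
    M * (y' - y) * (2 * B * eta + 12 * B * eta) by ring.
  apply: ler_wpM2l; first by rewrite mulr_ge0// subr_ge0.
  by rewrite lerD2r; apply: ler_wpM2l => //; rewrite mulr_ge0.
Qed.
End EdgeEstimate.

(** The scales are chosen in the order e, eta, delta, covering. This works because the total
    half-side L of the covering is fixed beforehand, so the error is of order eta times L. *)
Lemma cauchy_vanish (K : set R[i]) f (M : R) (x0 y0 l : R) z :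
  compact K -> totally_disconnected K -> (hausdorff_measure1 K < +oo)%E ->
  0 <= M -> (forall w, ~ K w -> exists2 D, cdiff f w D & normc D <= M) ->
  0 < l -> (forall p, K p -> x0 + 1 <= Re p <= x0 + l - 1 /\
                        y0 + 1 <= Im p <= y0 + l - 1) ->
  ~ K z -> x0 < Re z < x0 + l -> y0 < Im z < y0 + l ->
  rect (fun w => (f w - f z) * (w - z)^-1) x0 (x0 + l) y0 (y0 + l) = 0.
Proof.
move=> cK tdK HK M0 fM l0 KQ nKz /andP[zx0 zx1] /andP[zy0 zy1].
pose u w := f w - f z; pose k w := (w - z)^-1; pose h w := u w * k w.
rewrite -[fun w => _]/h.
have [L HL] := hausdorff_squares cK HK.
have [d d0 Hd] : exists2 d : R, 0 < d & forall p, K p -> d <= normc (p - z).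
  have : nbhs z (~` K) by apply: open_nbhs_nbhs; split=> //;
    exact/closed_openC/(compact_complex_closed cK).
  move=> /nbhs_normcP[r r0 Hr]; exists r => // p Kp; rewrite leNgt.
  by apply/negP => /Hr /(_ Kp).
have [Dz fDz DzM] := fM z nKz.
have [rz rz0 Hrz] := cdiff_lipschitz fDz DzM ltr01.
have [B B0 kB] : exists2 B : R, 0 <= B &
    forall w, d / 2 <= normc (w - z) -> normc (k w) <= B.
  exists (2 / d) => [|w dw]; first by rewrite divr_ge0// ltW.
  rewrite normcV -[2 / d]invrK invf_div lef_pV2// posrE ?divr_gt0//.
  by apply: lt_le_trans dw; rewrite divr_gt0.
have kd w : d / 2 <= normc (w - z) -> cdiffable k w.
  move=> dw; apply: cdiffable_kernel; rewrite -subr_eq0 -normc_gt0.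
  by apply: lt_le_trans dw; rewrite divr_gt0.
have away w p : K p -> normc (w - p) <= d / 2 -> d / 2 <= normc (w - z).
  by move=> /Hd dp wp; have := normc_triangle p w z; rewrite (normcB p w); move: dp wp;
    clear; lra.
have ud w : ~ K w -> exists2 D, cdiff u w D & normc D <= M.
  move=> /fM[D fD DM]; exists D => // e /fD[r r0 H]; exists r => // v /H.
  by rewrite /u opprB addrA subrK.
have hd w : ~ K w -> w != z -> cdiffable h w.
  move=> Kw wz; apply: cdiffableM; last exact: cdiffable_kernel.
  by have [D uD _] := ud _ Kw; exists D.
have [Bz Bz0 hBz] : exists2 Bz : R, 0 <= Bz &
    forall w, w != z -> normc (w - z) < rz -> normc (h w) <= Bz.
  (* Near z the integrand is a difference quotient of f, bounded by the local Lipschitz constant: M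
     plus the slack 1 used for [rz]. *)
  exists (M + 1) => [|w wz /Hrz uw]; first by rewrite addr_ge0.
  rewrite normcM normcV ler_pdivrMr//.
  by rewrite normc_gt0 subr_eq0.
(* With the 16 of [grid_estimate]: 32 is 16 times the 2 of [cint_bound], for the square at z; 224 is
   16 times the 14 of the edge estimates, for the squares on [K]. *)
apply: (@normc_eq0_eps _ _ (32 * Bz + 224 * M * B * `|L|)) => [|e e0].
  by apply: addr_ge0; do ?apply: mulr_ge0.
(* The paths to the base points stay within [4 * eta] of [K], so [d / 12] keeps them at distance at
   least [d / 2] from z. *)
pose eta := Num.min (d / 12) e.
have eta0 : 0 < eta by rewrite lt_min divr_gt0//=.
have eta0' := ltW eta0.
have etad : eta <= d / 12 by rewrite ge_min lexx.
have etae : eta <= e by rewrite ge_min lexx orbT.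
have [delta' delta'0 [r Hr]] := locally_constant_approx cK tdK eta0.
(* [d / 4] separates the zone near [K] from the square at z; 1 keeps the doubled squares inside the
   large one. *)
pose delta := Num.min delta' (Num.min (d / 4) 1).
have delta0 : 0 < delta by rewrite !lt_min delta'0 divr_gt0//=.
have dl1 : delta <= delta' by rewrite ge_min lexx.
have dl2 : delta <= d / 4 by rewrite !ge_min lexx orbT.
have dl3 : delta <= 1 by rewrite !ge_min lexx !orbT.
(* Points of a doubled square are within 4 half-sides of its centre, hence within delta. *)
have d80 : 0 < delta / 8 by rewrite divr_gt0.
have [S [SK Scov SL]] := HL _ d80.
pose margin := Num.min (Num.min (Re z - x0) (x0 + l - Re z))
                       (Num.min (Im z - y0) (y0 + l - Im z)).
have margin0 : 0 < margin by rewrite !lt_min !subr_gt0 zx0 zx1 zy0 zy1.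
have m1 : margin <= Re z - x0 by rewrite !ge_min lexx.
have m2 : margin <= x0 + l - Re z by rewrite !ge_min lexx !orbT.
have m3 : margin <= Im z - y0 by rewrite !ge_min lexx !orbT.
have m4 : margin <= y0 + l - Im z by rewrite !ge_min lexx !orbT.
(* In order: the doubled square at z stays in the large one; it stays away from the zone near [K];
   the Lipschitz bound holds on it; its contribution is of order e. *)
pose rho := Num.min (Num.min (margin / 4) (d / 16)) (Num.min (rz / 8) e).
have rho0 : 0 < rho by rewrite !lt_min !divr_gt0//=.
have rh1 : rho <= margin / 4 by rewrite !ge_min lexx.
have rh2 : rho <= d / 16 by rewrite !ge_min lexx !orbT.
have rh3 : rho <= rz / 8 by rewrite !ge_min lexx !orbT.
have rh4 : rho <= e by rewrite !ge_min lexx !orbT.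
pose kappa := 14 * M * B * eta.
have kappa0 : 0 <= kappa by do ?apply: mulr_ge0.
(* The extra entry encloses z. There F is 0 and the error per unit length is the plain bound
   [2 * Bz] on the integral. *)
pose T := (z, (rho, 2 * Bz)) :: [seq (ar.1, (ar.2, kappa)) | ar <- S].
have inT j : j \in T -> j = (z, (rho, 2 * Bz)) \/
    [/\ K j.1, 0 < j.2.1, j.2.1 <= delta / 8 & j.2.2 = kappa].
  rewrite inE => /predU1P[->|/mapP[ar /SK[Ka /andP[? ?]] ->]]; first by left.
  by right.
have avK x y : avoids T x y -> ~ K (x +i* y) /\ x +i* y != z.
  move=> av; split.
    move=> /Scov[ar arS [/= p1 p2]].
    apply: (av (ar.1, (ar.2, kappa))); last by split; exact: ltW.
    by rewrite inE; apply/orP; right; apply/mapP; exists ar.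
  apply/eqP => xyz; apply: (av (z, (rho, 2 * Bz))); first exact: mem_head.
  by rewrite -xyz; split; rewrite /= subrr normr0 ltW.
pose near v := exists p, K p /\ normc (v - p) < delta.
pose F v := if `[< near v >] then u v * primitive k (corner eta (r v)) v else 0.
have kbase p s t : K p -> Re p - 2 * eta <= s <= Re p + eta ->
    Im p - 2 * eta <= t <= Im p + eta ->
    cdiffable k (s +i* t) /\ normc (k (s +i* t)) <= B.
  move=> Kp /andP[s1 s2] /andP[t1 t2].
  have : d / 2 <= normc (s +i* t - z).
    apply: (away _ p) => //.
    apply: le_trans (in_closed_normc (_ : in_closed p (2 * eta) s t)) _; last first.
      by move: etad d0; clear; lra.
    by split; rewrite ler_norml; apply/andP; split; move: s1 s2 t1 t2 eta0'; clear; lra.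
  by move=> dw; split; [exact: kd|exact: kB].
(* Local constancy of r enters here: both ends of an edge get the same base point, so the edge
   estimates apply to the difference of F. *)
have pair v v' a : K a -> normc (v - a) < delta -> normc (v' - a) < delta ->
    normc (v - v') < delta ->
    [/\ F v = u v * primitive k (corner eta (r v')) v,
       F v' = u v' * primitive k (corner eta (r v')) v', K (r v'),
       normc (v - r v') <= eta & normc (v' - r v') <= eta].
  move=> Ka va va' vv.
  have [|||E _ vr] := Hr v v' a a Ka Ka; try exact: lt_le_trans dl1.
  have [|||_ Kr vr'] := Hr v' v a a Ka Ka; try exact: lt_le_trans dl1.
    by rewrite normcB; exact: lt_le_trans dl1.
  have nv : near v by exists a.
  have nv' : near v' by exists a.
  by rewrite /F !asboolT//; rewrite E in vr *; split.
have Fz w : normc (w - z) <= 4 * rho -> F w = 0.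
  move=> wz; rewrite /F asboolF// => -[p [Kp wp]].
  have := Hd _ Kp; have := normc_triangle p w z; rewrite (normcB p w).
  by move: wz wp rh2 dl2 d0; clear; lra.
have rzlt : 4 * rho < rz by move: rh3 rz0; clear; lra.
have r8delta (q c : R) : q <= delta / 8 -> c <= 2 * (2 * q) -> c < delta.
  by move: delta0; clear; lra.
apply: le_trans (@grid_estimate _ h F x0 y0 l eta T l0 eta0 _ _ _ _) _.
- move=> j /inT[->|[/KQ [/andP[? ?] /andP[? ?]] ? ? ->]] /=; split=> //; try lra.
- by move=> x y _ _ /avK[? ?]; exact: hd.
- move=> j /inT[->|[Ka r0 r8 ->]] x x' y xx' xeta c1 c2 av.
    have cx := in_closed_normc c1; have cx' := in_closed_normc c2.
    rewrite /= mulrA -natrM in cx cx'.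
    rewrite (Fz _ cx) (Fz _ cx') subr0 subr0 -[_.2.2 * _]mulrA.
    apply: cint_bound => // t tx.
      by apply/ccont_hor/cdiff_cont; have [? ?] := avK _ _ (av t tx); exact: hd.
    have [nKt ntz] := avK _ _ (av t tx); apply: hBz => //; apply: le_lt_trans rzlt.
    have := in_closed_normc (in_closed_hor c1 c2 tx).
    by rewrite /= mulrA -natrM.
  have cd t : x <= t <= x' -> normc (t +i* y - j.1) < delta.
    by move=> /(in_closed_hor c1 c2)/in_closed_normc; exact: r8delta.
  have st : x <= x <= x' by rewrite lexx xx'.
  have en : x <= x' <= x' by rewrite lexx xx'.
  have [|Fv Fv' Kr vr vr'] := pair (x +i* y) (x' +i* y) _ Ka (cd _ st) (cd _ en).
    rewrite normcB hor_sub ger0_norm ?subr_ge0//.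
    exact: (r8delta _ _ r8 (dist_in_closed c1.1 c2.1)).
  rewrite Fv Fv'; apply: edge_hor => //; first by move=> s t; exact: kbase.
  by move=> t tx; apply: ud; exact: (avK _ _ (av t tx)).1.
- move=> j /inT[->|[Ka r0 r8 ->]] x y y' yy' yeta c1 c2 av.
    have cx := in_closed_normc c1; have cx' := in_closed_normc c2.
    rewrite /= mulrA -natrM in cx cx'.
    rewrite (Fz _ cx) (Fz _ cx') subr0 subr0 -[_.2.2 * _]mulrA.
    rewrite normcM normc_i mul1r; apply: cint_bound => // t ty.
      by apply/ccont_ver/cdiff_cont; have [? ?] := avK _ _ (av t ty); exact: hd.
    have [nKt ntz] := avK _ _ (av t ty); apply: hBz => //; apply: le_lt_trans rzlt.
    have := in_closed_normc (in_closed_ver c1 c2 ty).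
    by rewrite /= mulrA -natrM.
  have cd t : y <= t <= y' -> normc (x +i* t - j.1) < delta.
    by move=> /(in_closed_ver c1 c2)/in_closed_normc; exact: r8delta.
  have st : y <= y <= y' by rewrite lexx yy'.
  have en : y <= y' <= y' by rewrite lexx yy'.
  have [|Fv Fv' Kr vr vr'] := pair (x +i* y) (x +i* y') _ Ka (cd _ st) (cd _ en).
    rewrite normcB ver_sub ger0_norm ?subr_ge0//.
    exact: (r8delta _ _ r8 (dist_in_closed c1.2 c2.2)).
  rewrite Fv Fv'; apply: edge_ver => //; first by move=> s t; exact: kbase.
  by move=> t ty; apply: ud; exact: (avK _ _ (av t ty)).1.
- rewrite big_cons big_map /=.
  have -> : \sum_(j <- S) 16 * kappa * j.2 = 16 * kappa * \sum_(j <- S) j.2.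
    by rewrite mulr_sumr.
  have S1 : \sum_(j <- S) j.2 <= `|L| by apply: le_trans SL _; exact: ler_norm.
  have S2 : 16 * kappa * \sum_(j <- S) j.2 <= 16 * kappa * `|L|.
    by apply: ler_wpM2l => //; rewrite mulr_ge0.
  have S3 : 16 * kappa * `|L| <= e * (224 * M * B * `|L|).
    have -> : 16 * kappa * `|L| = eta * (224 * M * B * `|L|) by rewrite /kappa; ring.
    by apply: ler_wpM2r => //; do ?apply: mulr_ge0.
  have S4 : 16 * (2 * Bz) * rho <= e * (32 * Bz).
    have -> : 16 * (2 * Bz) * rho = rho * (32 * Bz) by ring.
    by apply: ler_wpM2r => //; rewrite mulr_ge0.
  lra.
Qed.
End CauchyVanish.

(** * Cauchy integrals *)

Section CauchyIntegral.
Context {R : realType}.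
Implicit Types (f h phi : R[i] -> R[i]) (x y a b c d t : R) (w v z : R[i]).

Lemma icont_bounded (u : R -> R[i]) a b : a <= b -> icont u a b ->
  exists B : R, forall t, a <= t <= b -> normc (u t) <= B.
Proof.
move=> ab uc; have l0 : 0 <= b - a by rewrite subr_ge0.
have abE : a + (b - a) = b by rewrite addrC subrK.
pose ln n := (b - a) / 2 ^+ n : R.
pose P x (y : R) n := exists B : R, forall t, x <= t <= x + ln n -> normc (u t) <= B.
have lnS n : ln n = ln n.+1 + ln n.+1.
  by rewrite /ln exprS invfM; field; rewrite expf_neq0// pnatr_eq0.
suff : P a 0 0%N by rewrite /P /ln expr0 divr1 abE.
apply: (@bisection _ P a 0 (b - a) 0) => //.
  move=> x y n; rewrite -/(ln _) mul0r addr0 => -[B1 H1] [B2 H2] _ _.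
  exists (Num.max B1 B2) => t /andP[xt tx]; rewrite le_max.
  have [tl|tl] := leP t (x + ln n.+1); first by rewrite H1 ?xt.
  by rewrite H2 ?orbT// (ltW tl) -addrA -lnS.
move=> p q; rewrite abE => pab _; have [r r0 Hr] := uc p pab 1 ltr01.
exists r => // x y n; rewrite -/(ln _) => /andP[xp px] _ lr _.
exists (1 + normc (u p)) => t /andP[xt tx].
apply: le_trans (normc_le_sum _ (u p)) _; rewrite lerD2r; apply: Hr.
by rewrite ltr_norml; apply/andP; split; lra.
Qed.

Lemma boundary_bcontr h a b c d : a <= b -> c <= d ->
  (forall x y, on_boundary a b c d x y -> ccontC h (x +i* y)) -> bcontr h a b c d.
Proof.
move=> ab cd H; split=> t tab.
- by apply/ccont_hor/H; split; rewrite ?lexx//; constructor 3.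
- by apply/ccont_hor/H; split; rewrite ?lexx ?cd//; constructor 4.
- by apply/ccont_ver/H; split; rewrite ?lexx//; constructor 1.
- by apply/ccont_ver/H; split; rewrite ?lexx ?ab//; constructor 2.
Qed.

Lemma bcontrM h1 h2 a b c d : bcontr h1 a b c d -> bcontr h2 a b c d ->
  bcontr (fun w => h1 w * h2 w) a b c d.
Proof.
move=> [A1 A2 A3 A4] [B1 B2 B3 B4]; split=> t tab.
- by apply: (ccontM (A1 _ tab) (B1 _ tab)).
- by apply: (ccontM (A2 _ tab) (B2 _ tab)).
- by apply: (ccontM (A3 _ tab) (B3 _ tab)).
- by apply: (ccontM (A4 _ tab) (B4 _ tab)).
Qed.

Lemma bcontrZ k h a b c d : bcontr h a b c d -> bcontr (fun w => k * h w) a b c d.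
Proof.
by move=> [A1 A2 A3 A4]; split=> t tab; apply: ccontZ;
  [exact: A1|exact: A2|exact: A3|exact: A4].
Qed.

Lemma bcontrD h1 h2 a b c d : bcontr h1 a b c d -> bcontr h2 a b c d ->
  bcontr (fun w => h1 w + h2 w) a b c d.
Proof.
move=> [A1 A2 A3 A4] [B1 B2 B3 B4]; split=> t tab.
- by apply: (ccontD (A1 _ tab) (B1 _ tab)).
- by apply: (ccontD (A2 _ tab) (B2 _ tab)).
- by apply: (ccontD (A3 _ tab) (B3 _ tab)).
- by apply: (ccontD (A4 _ tab) (B4 _ tab)).
Qed.

Lemma bcontr_bounded h a b c d : a <= b -> c <= d -> bcontr h a b c d ->
  exists2 B : R, 0 <= B &
    forall x y, on_boundary a b c d x y -> normc (h (x +i* y)) <= B.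
Proof.
move=> ab cd [A1 A2 A3 A4].
have [B1 H1] := icont_bounded ab A1; have [B2 H2] := icont_bounded ab A2.
have [B3 H3] := icont_bounded cd A3; have [B4 H4] := icont_bounded cd A4.
exists (Num.max 0 (Num.max (Num.max B1 B2) (Num.max B3 B4))).
  by rewrite le_max lexx.
by move=> x y [xab ycd []->]; rewrite !le_max ?H1 ?H2 ?H3 ?H4 ?orbT.
Qed.

Lemma boundary_dist a b c d x y w (m : R) : on_boundary a b c d x y ->
  a + m <= Re w -> Re w <= b - m -> c + m <= Im w -> Im w <= d - m ->
  m <= normc (x +i* y - w).
Proof.
move=> [_ _ xy] wa wb wc wd.
have := Re_le_normc (x +i* y - w); have := Im_le_normc (x +i* y - w).
rewrite cReD cImD cReN cImN /= !ler_norml => /andP[? ?] /andP[? ?].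
by case: xy => ?; lra.
Qed.

Lemma kernel_expansion v w w' : v != w -> v != w' ->
  (v - w')^-1 - (v - w)^-1 - (w' - w) * ((v - w)^-1 * (v - w)^-1) =
  (w' - w) ^+ 2 * ((v - w)^-1 * (v - w)^-1 * (v - w')^-1).
Proof. by move=> vw vw'; field; rewrite !subr_eq0 vw vw'. Qed.

(** The first-order remainder of the kernel is exact and quadratic in [w' - w], with factors bounded
    on the sides. Only boundary values of phi enter, so phi may be arbitrary inside. *)
Lemma cauchy_integral_cdiff phi a b c d w : a <= b -> c <= d ->
  bcontr phi a b c d -> a < Re w < b -> c < Im w < d ->
  cdiff (fun z => rect (fun v => phi v * (v - z)^-1) a b c d) w
    (rect (fun v => phi v * ((v - w)^-1 * (v - w)^-1)) a b c d).
Proof.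
move=> ab cd phic /andP[aw wb] /andP[cw wd].
pose m := Num.min (Num.min (Re w - a) (b - Re w)) (Num.min (Im w - c) (d - Im w)).
have m0 : 0 < m by rewrite !lt_min !subr_gt0 aw wb cw wd.
have m1 : m <= Re w - a by rewrite !ge_min lexx.
have m2 : m <= b - Re w by rewrite !ge_min lexx !orbT.
have m3 : m <= Im w - c by rewrite !ge_min lexx !orbT.
have m4 : m <= d - Im w by rewrite !ge_min lexx !orbT.
have wdist x y : on_boundary a b c d x y -> m <= normc (x +i* y - w).
  by move=> xy; apply: boundary_dist xy _ _ _ _; lra.
have [B B0 HB] := bcontr_bounded ab cd phic.
have kc w' : (forall x y, on_boundary a b c d x y -> x +i* y != w') ->
    bcontr (fun v => (v - w')^-1) a b c d.
  move=> H; apply: boundary_bcontr => // x y /H xyw.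
  by apply: cdiff_cont; exact: cdiffable_kernel.
have nw x y : on_boundary a b c d x y -> x +i* y != w.
  by move=> /wdist mw; rewrite -subr_eq0 -normc_gt0; exact: lt_le_trans mw.
move=> e e0.
(* The boundary is at distance at least m from w and [m / 2] from w'; 4 is the constant of
   [rect_bound]. *)
pose C := 4 * (B * (m^-1 * m^-1 * (2 / m))) * ((b - a) + (d - c)).
have C0 : 0 <= C.
  have ba : 0 <= (b - a) + (d - c) by rewrite addr_ge0// subr_ge0.
  by rewrite /C mulr_ge0// mulr_ge0// mulr_ge0// !mulr_ge0// ?invr_ge0 ?divr_ge0 ltW.
have C1 : 0 < C + 1 by rewrite ltr_wpDl.
exists (Num.min (m / 2) (e / (C + 1))); first by rewrite lt_min !divr_gt0.
move=> w'; rewrite lt_min => /andP[w1 w2].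
have w'dist x y : on_boundary a b c d x y -> m / 2 <= normc (x +i* y - w').
  by move=> /wdist; have := normc_triangle (x +i* y) w' w; lra.
have nw' x y : on_boundary a b c d x y -> x +i* y != w'.
  move=> /w'dist mw; rewrite -subr_eq0 -normc_gt0; apply: lt_le_trans mw.
  by rewrite divr_gt0.
have kw := kc w nw; have kw' := kc w' nw'.
have A1 := bcontrM phic kw'; have A2 := bcontrM phic kw.
have A3 := bcontrM phic (bcontrM kw kw).
pose E v := phi v * (v - w')^-1 + (-1 * (phi v * (v - w)^-1) +
   (- (w' - w)) * (phi v * ((v - w)^-1 * (v - w)^-1))).
have EE : rect (fun v => phi v * (v - w')^-1) a b c d -
    rect (fun v => phi v * (v - w)^-1) a b c d -
    rect (fun v => phi v * ((v - w)^-1 * (v - w)^-1)) a b c d * (w' - w) =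
    rect E a b c d.
  rewrite /E rectD//; last by apply: bcontrD; exact: bcontrZ.
  by rewrite rectD ?rectZ//; [ring|exact: bcontrZ|exact: bcontrZ].
rewrite EE.
have Ec : bcontr E a b c d.
  by apply: bcontrD => //; apply: bcontrD; exact: bcontrZ.
set D := normc (w' - w).
have D0 : 0 <= D := normc_ge0 _.
have EB x y : on_boundary a b c d x y ->
    normc (E (x +i* y)) <= D ^+ 2 * (B * (m^-1 * m^-1 * (2 / m))).
  move=> xy; have -> : E (x +i* y) = phi (x +i* y) * ((x +i* y - w')^-1 -
      (x +i* y - w)^-1 - (w' - w) * ((x +i* y - w)^-1 * (x +i* y - w)^-1)).
    by rewrite /E; ring.
  rewrite kernel_expansion; [|exact: nw|exact: nw'].
  rewrite !normcM !normcV mulrCA.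
  have I1 : (normc (x +i* y - w))^-1 <= m^-1.
    by rewrite lef_pV2 ?posrE ?wdist//; apply: lt_le_trans (wdist _ _ xy).
  have I2 : (normc (x +i* y - w'))^-1 <= 2 / m.
    rewrite -[2 / m]invrK invf_div lef_pV2 ?posrE ?w'dist ?divr_gt0//.
    by apply: lt_le_trans (w'dist _ _ xy); rewrite divr_gt0.
  have V0 z : 0 <= (normc z)^-1 by rewrite invr_ge0 normc_ge0.
  rewrite -/D -expr2; apply: ler_wpM2l; first by rewrite sqr_ge0.
  apply: ler_pM; rewrite ?normc_ge0 ?HB// ?mulr_ge0//.
  apply: ler_pM; rewrite ?mulr_ge0//.
  by apply: ler_pM.
apply: le_trans (rect_bound ab cd Ec EB) _.
have -> : 4 * (D ^+ 2 * (B * (m^-1 * m^-1 * (2 / m)))) * ((b - a) + (d - c)) =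
  (C * D) * D by rewrite /C; ring.
apply: ler_wpM2r => //.
move: w2; rewrite ltr_pdivlMr// -/D => w2.
by apply: le_trans (ltW w2); rewrite mulrC ler_wpM2l// lerDl.
Qed.

(** The imaginary part contributed by a side is the angle it subtends at the inner point. All four
    have the same sign, so strict positivity on the lower side suffices. *)
Lemma rect_kernel_Im_gt0 a b c d (p q : R) : a < p < b -> c < q < d ->
  0 < Im (rect (fun v => (v - (p +i* q))^-1) a b c d).
Proof.
move=> /andP[ap pb] /andP[cq qd].
have ab : a <= b by rewrite ltW// (lt_trans ap).
have cd : c <= d by rewrite ltW// (lt_trans cq).
have ab0 : 0 < b - a by rewrite subr_gt0 (lt_trans ap).
have nw x y : on_boundary a b c d x y -> x +i* y != p +i* q.
  move=> [_ _ xy]; apply/eqP => -[xp yq]; rewrite {}xp {}yq in xy.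
  by case: xy => E; move: ap pb cq qd; rewrite E ltxx.
have [k1 k2 k3 k4] : bcontr (fun v => (v - (p +i* q))^-1) a b c d.
  apply: boundary_bcontr => // x y /nw xyw.
  by apply: cdiff_cont; exact: cdiffable_kernel.
have kE x y : (x +i* y - (p +i* q))^-1 =
   ((x - p) / ((x - p) ^+ 2 + (y - q) ^+ 2)) +i*
   (- ((y - q) / ((x - p) ^+ 2 + (y - q) ^+ 2))) :> R[i] by [].
have S0 (x y : R) : 0 <= x ^+ 2 + y ^+ 2 by rewrite addr_ge0 ?sqr_ge0.
pose h v := (v - (p +i* q))^-1.
have H1 : 0 < Im (hor h c a b).
  pose D := (b - a) ^+ 2 + (q - c) ^+ 2.
  have D0 : 0 < D by rewrite ltr_wpDr ?sqr_ge0// exprn_gt0.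
  apply: lt_le_trans (_ : (q - c) / D * (b - a) <= _).
    by rewrite mulr_gt0// divr_gt0// subr_gt0.
  apply: Rint_ge => //; first exact: icont_Im.
  move=> t /andP[at' tb]; rewrite /h kE /= -mulNr opprB.
  have qc : 0 < q - c by rewrite subr_gt0.
  have E : (c - q) ^+ 2 = (q - c) ^+ 2 by ring.
  rewrite E ler_wpM2l ?(ltW qc)// lef_pV2 ?posrE//.
    rewrite lerD2r -[(t - p) ^+ 2]real_normK ?num_real// ler_sqr ?nnegrE ?(ltW ab0)//.
    by rewrite ler_norml; apply/andP; split; lra.
  by rewrite ltr_wpDl ?sqr_ge0// exprn_gt0.
have H2 : Im (hor h d a b) <= 0.
  rewrite -(mul0r (b - a)); apply: Rint_le => //; first exact: icont_Im.
  move=> t _; rewrite /h kE /= oppr_le0 divr_ge0// subr_ge0 ltW//.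
have ImV x : Im (ver h x c d) = Re (cint (fun t => h (x +i* t)) c d).
  by rewrite /ver cImM /= mul0r add0r mul1r.
have H3 : 0 <= Im (ver h b c d).
  rewrite ImV -(mul0r (d - c)); apply: Rint_ge => //; first exact: icont_Re.
  by move=> t _; rewrite /h kE /= divr_ge0// subr_ge0 ltW.
have H4 : Im (ver h a c d) <= 0.
  rewrite ImV -(mul0r (d - c)); apply: Rint_le => //; first exact: icont_Re.
  move=> t _; rewrite /h kE /= -oppr_ge0 -mulNr opprB divr_ge0// subr_ge0 ltW//.
rewrite /rect -/h !cImD !cImN; lra.
Qed.
End CauchyIntegral.

(** * Extension across the compact set *)

Lemma compact_normc_bounded (R : realType) (K : set R[i]) : compact K ->
  exists2 B : R, 0 <= B & forall p, K p -> normc p <= B.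
Proof.
move=> cK.
have [d d0 Hd] : exists2 d : R, 0 < d & forall p, K p -> normc p <= d^-1.
  (* The bound is written as [d^-1], which weakens as d shrinks, to fit the uniform principle. *)
  apply: compact_uniform => // p Kp.
  have n0 : 0 < normc p + 1 by rewrite ltr_wpDl// normc_ge0.
  exists (Num.min 1 (normc p + 1)^-1); first by rewrite lt_min ltr01 invr_gt0.
  move=> q d _; rewrite !lt_min => /andP[qp _] /and3P[d0 _ dp].
  have : normc q <= normc p + 1 by have := normc_le_sum q p; lra.
  move/le_trans; apply; rewrite -[normc p + 1]invrK.
  by rewrite lef_pV2 ?posrE ?invr_gt0// ltW.
by exists d^-1 => //; rewrite invr_ge0 ltW.
Qed.

Theorem corollary5p2 (R : realType) (K : set R[i]) :
  compact K -> totally_disconnected K ->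
  (hausdorff_measure1 K < +oo)%E ->
  removable_bounded_derivative K.
Proof.
move=> cK tdK HK f fhol fsup.
have [M M0 fM] : exists2 M : R, 0 <= M &
    forall w, ~ K w -> exists2 D, cdiff f w D & normc D <= M.
  have [M fM] : exists M : R, (ereal_sup [set (normc (derive1 f z))%:E | z in ~` K] <=
    M%:E)%E.
    case: (ereal_sup _) fsup => [r _|//|_]; first by exists r.
    by exists 0; rewrite leNye.
  exists (Num.max 0 M) => [|w nKw]; first by rewrite le_max lexx.
  exists (derive1 f w); first exact/derivable_cdiff/fhol.
  rewrite le_max -(lee_fin _ M); apply/orP; right; apply: le_trans fM.
  by apply: ereal_sup_ubound; exists w.
have vanish := fun x0 y0 l z => @cauchy_vanish R K f M x0 y0 l z cK tdK HK M0 fM.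
clear fhol fsup HK; have [B B0 HB] := compact_normc_bounded cK.
(* The square of half-side [B + 1] about 0 leaves a margin 1 around [K]. *)
pose x0 := - B - 1; pose l := 2 * B + 2; pose x1 := x0 + l.
have l0 : 0 < l by rewrite /l; lra.
have x01 : x0 <= x1 by rewrite /x1 lerDl ltW.
have KQ p : K p -> x0 + 1 <= Re p <= x0 + l - 1 /\ x0 + 1 <= Im p <= x0 + l - 1.
  move=> /HB pB; have := Re_le_normc p; have := Im_le_normc p.
  rewrite !ler_norml => /andP[? ?] /andP[? ?].
  by rewrite /x0 /l; split; apply/andP; split; lra.
pose inside w := (x0 < Re w < x1) && (x0 < Im w < x1).
pose num w := rect (fun v => f v * (v - w)^-1) x0 x1 x0 x1.
(* The factor 1 makes this the Cauchy integral of a constant density, so the same differentiability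
   lemma serves [num] and [den]. *)
pose den w := rect (fun v => 1 * (v - w)^-1) x0 x1 x0 x1.
have bK x y : on_boundary x0 x1 x0 x1 x y -> ~ K (x +i* y).
  move=> [_ _ xy] /KQ[/= /andP[? ?] /andP[? ?]].
  by rewrite /x1 in xy; case: xy => ?; lra.
have fc : bcontr f x0 x1 x0 x1.
  apply: boundary_bcontr => // x y /bK/fM[D fD _].
  by apply: cdiff_cont; exists D.
have onec : bcontr (fun=> 1) x0 x1 x0 x1 by split=> t _; exact: ccont_cst.
have num_d w : inside w -> cdiffable num w.
  by move=> /andP[w1 w2]; eexists; exact: cauchy_integral_cdiff.
have den_d w : inside w -> cdiffable den w.
  by move=> /andP[w1 w2]; eexists; exact: cauchy_integral_cdiff onec _ _.
have denE w : den w = rect (fun v => (v - w)^-1) x0 x1 x0 x1.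
  have -> : (fun v => (v - w)^-1) = (fun v => 1 * (v - w)^-1).
    by apply/funext => v; rewrite mul1r.
  by [].
have den0 w : inside w -> den w != 0.
  case: w => p q /andP[w1 w2]; apply/eqP; rewrite denE => E.
  by have := rect_kernel_Im_gt0 w1 w2; rewrite E ltxx.
(* By linearity this is the vanishing of the integral of [(f v - f w) / (v - w)]. *)
have numE w : inside w -> ~ K w -> num w = f w * den w.
  move=> iw nKw; have /andP[w1 w2] := iw.
  have nw x y : on_boundary x0 x1 x0 x1 x y -> x +i* y != w.
    move=> [_ _ xy]; apply/eqP => E; move: w1 w2; rewrite -E /=.
    by case: xy => -> /andP[? ?] /andP[? ?]; lra.
  have kc : bcontr (fun v => (v - w)^-1) x0 x1 x0 x1.
    apply: boundary_bcontr => // x y /nw xyw.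
    by apply: cdiff_cont; exact: cdiffable_kernel.
  apply/eqP; rewrite -subr_eq0; apply/eqP.
  rewrite -(vanish _ _ _ _ l0 KQ nKw w1 w2) -/x1.
  rewrite -mulNr /num /den -rectZ; last exact: bcontrM.
  rewrite -rectD; [|exact: bcontrM|by apply/bcontrZ/bcontrM].
  by congr (rect _ x0 x1 x0 x1); apply/funext => v; ring.
pose g w := if inside w then num w / den w else f w.
have gE w : ~ K w -> g w = f w.
  rewrite /g; case: ifP => // iw nKw.
  by rewrite numE// mulfK// den0.
exists g; split=> // w _; apply/cdiffableP.
have [Kw|nKw] := pselect (K w); last first.
  have [D fD _] := fM w nKw; exists D.
  have : nbhs w (~` K) by apply: open_nbhs_nbhs; split=> //;
    exact/closed_openC/(compact_complex_closed cK).
  move=> /nbhs_normcP[r r0 Hr]; apply: (cdiff_near r0 _ fD) => v /Hr nKv.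
  by rewrite gE.
have iw : inside w.
  by have [/andP[? ?] /andP[? ?]] := KQ w Kw; rewrite /inside /x1; apply/andP; split;
    apply/andP; split; lra.
have [D hD] : cdiffable (fun v => num v * (den v)^-1) w.
  by apply: cdiffableM; [exact: num_d|apply: cdiffableV; [exact: den0|exact: den_d]].
(* The margin 1 puts the whole unit disc about a point of [K] inside the square, where g is the
   quotient. *)
exists D; apply: (cdiff_near (ltr01 : 0 < 1 :> R) _ hD) => v wv.
rewrite /g ifT//.
have := KQ w Kw; have := Re_le_normc (v - w); have := Im_le_normc (v - w).
rewrite cReD cImD cReN cImN !ler_norml => /andP[? ?] /andP[? ?] [/andP[? ?] /andP[? ?]].
by rewrite /inside /x1; apply/andP; split; apply/andP; split; lra.
Qed.
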